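(* Let $n$ be a large natural number and consider the $(1:K_m)$-biased games on $K_n$. Then: (1) the threshold bias for the triangle game $\mathcal{F}_{K_3}(K_m,n)$ is $m=\Theta(\sqrt{n})$; (2) the threshold bias for the connectivity game $\mathcal{C}(K_m,n)$ is $m=\Theta\big(\sqrt{n/\ln n}\big)$; (3) the threshold bias for the Hamiltonicity game $\mathcal{H}(K_m,n)$ is $m=\Theta\big(\sqrt{n/\ln n}\big)$.
   Context: Structure-biased Maker-Breaker game on $K_n$: the board is the edge set of $K_n$; Maker and Breaker alternate turns; on each turn Maker claims one unclaimed edge, while Breaker claims a set of unclaimed edges forming (a subgraph of) a copy of a given graph $H$ in $K_n$. For the $(1:K_m)$ bias, on each turn Breaker claims any set of unclaimed edges all of whose endpoints lie in some set of $m$ vertices. The game ends when no unclaimed edges remain. In $\mathcal{F}_{K_3}$ Maker wins if her graph contains a triangle; in $\mathcal{C}$ Maker wins if her graph contains a spanning tree of $K_n$; in $\mathcal{H}$ Maker wins if her graph contains a Hamiltonian path of $K_n$; otherwise Breaker wins. The threshold bias is the value $m_0(n)$ such that Breaker wins if the bias parameter exceeds $m_0$ and Maker wins if the parameter is at most $m_0$. Convention: when considering Maker strategies Breaker makes the first move, and when considering Breaker strategies Maker makes the first move. *)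

(* Defs.v *)
From mathcomp Require Import all_boot all_order all_algebra.
From mathcomp Require Import all_classical all_reals all_analysis.
Set Implicit Arguments.
Unset Strict Implicit.
Unset Printing Implicit Defensive.
Import Order.TTheory GRing.Theory Num.Theory.
Import numFieldNormedType.Exports.


Definition graph (n : nat) := {set {set 'I_n}}.

Definition Kn_edges (n : nat) : graph n :=
  [set e : {set 'I_n} | #|e| == 2]%SET.

Definition adj (n : nat) (G : graph n) : rel 'I_n :=
  [rel x y | (x != y) && ([set x; y]%SET \in G)].

Inductive player := Maker | Breaker.

Definition opponent (p : player) : player :=
  match p with Maker => Breaker | Breaker => Maker end.

Record position (n : nat) :=
  Position { maker_graph : graph n; breaker_graph : graph n }.

Definition unclaimed (n : nat) (P : position n) : graph n :=
  Kn_edges n :\: (maker_graph P :|: breaker_graph P).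

(* [#|S| <= m] rather than [#|S| = m]: the two give the same moves when
   m <= n, and for m > n the former lets Breaker claim any unclaimed edges. *)
Definition legal_move (n m : nat) (p : player) (P : position n) (F : graph n) :
    Prop :=
  match p with
  | Maker => exists2 e, e \in unclaimed P & F = [set e]%SET
  | Breaker => F \subset unclaimed P /\
      exists2 S : {set 'I_n}, #|S| <= m & forall e, e \in F -> e \subset S
  end.

Definition claim (n : nat) (p : player) (P : position n) (F : graph n) :
    position n :=
  match p with
  | Maker => Position (maker_graph P :|: F) (breaker_graph P)
  | Breaker => Position (maker_graph P) (breaker_graph P :|: F)
  end.

(* The sequence of all moves made so far, the most recent move at the head. *)
Definition history (n : nat) := seq (graph n).

Definition turn (n : nat) (first : player) (h : history n) : player :=
  if odd (size h) then opponent first else first.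

Fixpoint position_after (n : nat) (first : player) (h : history n) :
    position n :=
  match h with
  | [::] => Position finset.set0 finset.set0
  | F :: h' => claim (turn first h') (position_after first h') F
  end.

Definition game_over (n : nat) (first : player) (h : history n) : Prop :=
  unclaimed (position_after first h) = finset.set0.

Definition strategy (n : nat) := history n -> graph n.

(* [h] is a legal, possibly unfinished, play in which [p] follows [s]. *)
Fixpoint played_by (n m : nat) (first p : player) (s : strategy n)
    (h : history n) : Prop :=
  match h with
  | [::] => True
  | F :: h' => [/\ played_by m first p s h', ~ game_over first h',
      legal_move m (turn first h') (position_after first h') F
      & turn first h' = p -> F = s h']
  end.

(* A family of Maker's winning graphs, for each number of vertices. *)
Definition winning_family := forall n : nat, graph n -> Prop.

Definition won_by (W : winning_family) (n : nat) (p : player)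
    (P : position n) : Prop :=
  match p with
  | Maker => W n (maker_graph P)
  | Breaker => ~ W n (maker_graph P)
  end.

(* Every play ends, because Maker claims an edge in each of her turns; the
   second clause prevents a strategy from winning by prescribing an illegal
   move. *)
Definition winning_strategy (W : winning_family) (n m : nat)
    (first p : player) (s : strategy n) : Prop :=
  forall h : history n, played_by m first p s h ->
    (game_over first h -> won_by W p (position_after first h)) /\
    (~ game_over first h -> turn first h = p ->
       legal_move m p (position_after first h) (s h)).

Definition wins (W : winning_family) (n m : nat) (first p : player) : Prop :=
  exists s : strategy n, winning_strategy W m first p s.

Definition threshold_bias (W : winning_family) (first : player) (n m0 : nat) :
    Prop :=
  forall m : nat, (m <= m0 -> wins W n m first Maker) /\
                  (m0 < m -> wins W n m first Breaker).

Definition triangle_game : winning_family := fun n G =>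
  exists x y z : 'I_n, [/\ adj G x y, adj G y z & adj G x z].

Definition connected_graph (n : nat) (G : graph n) : Prop :=
  forall x y : 'I_n, connect (adj G) x y.

Definition acyclic_graph (n : nat) (G : graph n) : Prop :=
  forall c : seq 'I_n, 2 < size c -> ~ ucycle (adj G) c.

Definition spanning_tree (n : nat) (T : graph n) : Prop :=
  [/\ T \subset Kn_edges n, connected_graph T & acyclic_graph T].

Definition connectivity_game : winning_family := fun n G =>
  exists2 T : graph n, T \subset G & spanning_tree T.

Definition hamiltonicity_game : winning_family := fun n G =>
  exists s : seq 'I_n, [/\ uniq s, size s = n & sorted (adj G) s].

Local Open Scope ring_scope.
Local Open Scope classical_set_scope.

(* Maker's strategies are to be tested with Breaker moving first and Breaker's
   strategies with Maker moving first. As no single order of play does both,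
   the threshold is required to have order f for each choice of the player
   who moves first. *)
Definition threshold_bias_Theta (R : realType) (W : winning_family)
    (f : nat -> R) : Prop :=
  forall first : player, exists m0 : nat -> nat,
    (\forall n \near \oo, threshold_bias W first n (m0 n)) /\
    (fun n => (m0 n)%:R : R) =Theta_\oo f.

(* Main.v *)
(* The game is finite, hence determined, and Maker's wins are monotone in m;
   so a threshold exists, and it suffices that Maker wins at some m >= c f(n)
   and Breaker wins at every m > C f(n).

   Triangle. Maker builds a star with 2m leaves at v, then joins v to a vertex u
   having more than m unclaimed edges to the leaves: Breaker meets at most m of
   these leaves in his next turn. Breaker answers an edge uv by the clique on u, v,
   their Maker-neighbours and about sqrt n further free neighbours of each; this
   closes all threats and keeps Maker's degrees below about sqrt n.

   Connectivity, Breaker. The vertices are cut into n/h blocks, h = m/2. In sweep j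
   Breaker joins all vertices still untouched by Maker to block j, h of them per
   turn. Maker destroys two candidates per turn, so a sweep multiplies their number
   by about 1 - 4/h, and some vertex survives all sweeps when h^2 >= C n / ln n.

   Hamiltonicity, Maker. A move of Breaker has at most m^2 edges, so by Beck's
   potential argument Maker can hit all members of a family X of edge sets with
   sum_X 2^(-|X|/O(m^2)) small. The family consists of the cuts between A and
   the complement of A u B with |B| <= 8|A|, and, for every graph G with O(n)
   edges, of two sets of size of order n^2: the edges joining a fixed fraction of
   the pairs of disjoint linear-sized sets not joined by G, and the edges lengthening
   the longest paths of G. A graph M hitting the family contains, by greedy choice, a
   graph with O(n) edges joining all such pairs; adding disjoint stars found by
   Hall's theorem at a small exceptional set makes it expand. By Posa's
   rotations it then has quadratically many boosters as long as it is not
   traceable, so M contains one, and iterating gives a Hamiltonian path. *)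
Require Import Defs.
From mathcomp Require Import all_boot all_order all_algebra.
From mathcomp Require Import boolp.
From mathcomp Require Import zify ring lra.
Set Implicit Arguments.
Unset Strict Implicit.
Unset Printing Implicit Defensive.
Import Order.TTheory GRing.Theory Num.Theory.

(** * Hall's theorem *)

(* Rado's argument: if neither of two elements of [e a] can be removed, the
   sets [A1], [A2] violating Hall's condition after each removal contradict the
   condition for [A1 :|: A2] and [A1 :&: A2 :\ a]. *)
Theorem hall_matching (L R : finType) (e : L -> {set R}) :
  (forall A : {set L}, #|A| <= #|\bigcup_(a in A) e a|) ->
  exists2 f : L -> R, injective f & forall a, f a \in e a.
Proof.
have [N] := ubnP (\sum_a #|e a|).
elim: N e => // N IH e ltN hallP.
have [a le1|sm] := pickP [pred a | 1 < #|e a|]; last first.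
  have e1 a : exists b, e a == [set b].
    suff /cards1P [b ->] : #|e a| == 1 by exists b.
    rewrite eqn_leq leqNgt; have /= -> := sm a.
    by have := hallP [set a]; rewrite cards1 big_set1.
  pose f a := xchoose (e1 a).
  have ef a : e a = [set f a] by apply/eqP; exact: (xchooseP (e1 a)).
  exists f => [a a' eqf|a]; last by rewrite ef set11.
  apply/eqP; apply: contraT => neq.
  have := hallP [set a; a'].
  by rewrite cards2 neq big_setU1 ?inE //= big_set1 !ef eqf setUid cards1.
have /card_gt1P [b1 [b2 [b1e b2e neq]]] := le1.
pose red b a' := if a' == a then e a :\ b else e a'.
have redP b : b \in e a ->
    (exists2 f : L -> R, injective f & forall a', f a' \in e a') \/
    exists2 A : {set L}, a \in A & #|\bigcup_(a' in A) red b a'| < #|A|.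
  move=> be; pose viol := [exists A : {set L}, #|\bigcup_(a' in A) red b a'| < #|A|].
  case: (boolP viol) => [/existsP [A ltA]|/existsPn nov]; [right|left].
    exists A => //; apply: contraLR ltA => aA; rewrite -leqNgt.
    rewrite (eq_bigr e) ?hallP // => a' a'A; rewrite /red; case: eqP => // eqa.
    by rewrite -eqa a'A in aA.
  have [||f finj fin] := IH (red b).
  - rewrite ltnS in ltN; apply: leq_trans ltN.
    rewrite (bigD1 a) //= [X in _ < X](bigD1 a) //=.
    rewrite -addSn leq_add //; first by rewrite /red eqxx [X in _ < X](cardsD1 b) be.
    by apply: leq_sum => i /negPf ia; rewrite /red ia.
  - by move=> A; rewrite leqNgt.
  - exists f => // a'; have := fin a'; rewrite /red; case: eqP => [->|//].
    by rewrite inE => /andP[].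
have [//|[A1 aA1 lt1]] := redP b1 b1e; have [//|[A2 aA2 lt2]] := redP b2 b2e.
set N1 := \bigcup_(a' in A1) _ in lt1; set N2 := \bigcup_(a' in A2) _ in lt2.
have sU : \bigcup_(a' in A1 :|: A2) e a' \subset N1 :|: N2.
  apply/bigcupsP => a' a'A; have [->|na] := eqVneq a' a.
    apply/subsetP => y ye; have [y1|y1] := eqVneq y b1.
      rewrite inE orbC; apply/orP; left; apply/bigcupP; exists a => //.
      by rewrite /red eqxx !inE ye y1 neq.
    by rewrite inE; apply/orP; left; apply/bigcupP; exists a => //; rewrite /red eqxx !inE ye y1.
  move: a'A; rewrite inE => /orP[a'A|a'A].
    apply: subset_trans (subsetUl _ _); apply: (bigcup_max a') => //.
    by rewrite /red (negPf na).
  apply: subset_trans (subsetUr _ _); apply: (bigcup_max a') => //.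
  by rewrite /red (negPf na).
have sI : \bigcup_(a' in (A1 :&: A2) :\ a) e a' \subset N1 :&: N2.
  apply/bigcupsP => a'; rewrite !inE => /and3P[na a1 a2].
  by rewrite subsetI; apply/andP; split; apply: (bigcup_max a') => //; rewrite /red (negPf na).
(* Hall's condition gives [#|A1| + #|A2| - 1 <= #|N1| + #|N2|], while [lt1] and [lt2] give
   [#|N1| + #|N2| <= #|A1| + #|A2| - 2]. *)
have := subset_leq_card sU; have := subset_leq_card sI.
have := hallP (A1 :|: A2); have := hallP ((A1 :&: A2) :\ a).
have := cardsUI A1 A2; have := cardsUI N1 N2.
have := cardsD1 a (A1 :&: A2); rewrite inE aA1 aA2 /=.
lia.
Qed.

(** * Pósa rotations *)

Section Rotations.
Variables (T : finType) (e : rel T).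
Hypothesis e_sym : symmetric e.

Definition closed_nbh (A : {set T}) : {set T} :=
  A :|: [set u | [exists v in A, e v u]].

(** A Pósa rotation: the edge from the last vertex to [w] replaces the edge [wz]. The first vertex
    and the vertex set stay fixed, and [z] becomes the last vertex. *)
Inductive rotated (p : seq T) : seq T -> Prop :=
| Rotated0 : rotated p p
| RotatedS q1 w z q2 : rotated p (q1 ++ w :: z :: q2) -> e (last z q2) w ->
    rotated p (q1 ++ w :: rev (z :: q2)).

Definition consecutive (q : seq T) (a b : T) : Prop :=
  exists q1 q2, q = q1 ++ a :: b :: q2 \/ q = q1 ++ b :: a :: q2.

Lemma consecutive_sym q a b : consecutive q a b -> consecutive q b a.
Proof. by case=> q1 [q2 H]; exists q1, q2; case: H; [right|left]. Qed.

Lemma consecutive_rev q a b : consecutive (rev q) a b -> consecutive q a b.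
Proof.
case=> q1 [q2 H]; exists (rev q2), (rev q1); rewrite -[q]revK.
by case: H => ->; [right|left]; rewrite rev_cat !rev_cons -!cats1 -!catA.
Qed.

Lemma consecutive_cat q q' a b : consecutive (q ++ q') a b ->
  [\/ consecutive q a b, consecutive q' a b |
      exists q1 q2 c d, [/\ q = rcons q1 c, q' = d :: q2 &
        (a = c /\ b = d) \/ (a = d /\ b = c)]].
Proof.
have main x y (q1 q2 : seq T) : q ++ q' = q1 ++ x :: y :: q2 ->
    [\/ exists r1 r2, q = r1 ++ x :: y :: r2,
        exists r1 r2, q' = r1 ++ x :: y :: r2 |
        exists r1 r2, q = rcons r1 x /\ q' = y :: r2].
  elim: q q1 => [|c q IH] [|c1 q1] /=.
  - by move=> ->; constructor 2; exists [::], q2.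
  - by move=> ->; constructor 2; exists (c1 :: q1), q2.
  - case: q IH => [|d q] IH [-> E].
      by constructor 3; exists [::], q2.
    by case: E => -> E; constructor 1; exists [::], q.
  - case=> -> /IH [[r1 [r2 ->]]|[r1 [r2 ->]]|[r1 [r2 [-> ->]]]].
    + by constructor 1; exists (c1 :: r1), r2.
    + by constructor 2; exists r1, r2.
    + by constructor 3; exists (c1 :: r1), r2.
case=> q1 [q2 [] /main [[r1 [r2 ->]]|[r1 [r2 ->]]|[r1 [r2 [-> ->]]]]].
- by constructor 1; exists r1, r2; left.
- by constructor 2; exists r1, r2; left.
- by constructor 3; exists r1, r2, a, b; split=> //; left.
- by constructor 1; exists r1, r2; right.
- by constructor 2; exists r1, r2; right.
- by constructor 3; exists r1, r2, b, a; split=> //; right.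
Qed.

Lemma rotated_perm p q : rotated p q -> perm_eq q p.
Proof.
elim=> [|q1 w z q2 _ IH _]; first exact: perm_refl.
by apply: perm_trans IH; rewrite perm_cat2l perm_cons perm_rev.
Qed.

Lemma rotated_head p q x : rotated p q -> head x q = head x p.
Proof. by elim=> // -[|c q1] w z q2 _ IH _. Qed.

Lemma sorted_rev_sym (q : seq T) : sorted e (rev q) = sorted e q.
Proof.
by rewrite rev_sorted; apply: (eq_sorted (fun x y => e_sym y x)).
Qed.

Lemma rotated_sorted p q : sorted e p -> rotated p q -> sorted e q.
Proof.
move=> sp; elim=> // q1 w z q2 _ IH ew.
have sz : sorted e (rev (z :: q2)).
  by rewrite sorted_rev_sym; case: q1 IH => [|c q1] /=; rewrite ?cat_path /=; case/andP=> // _ /and3P[].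
have lz : e w (head z (rev (z :: q2))).
  by rewrite e_sym lastI rev_rcons.
move: sz lz; case: (rev _) (size_rev (z :: q2)) => [//|c r] _ /= pr ewc.
case: q1 IH => [|d q1] /=; first by rewrite ewc.
by rewrite !cat_path /= ewc pr !andbT => /and3P[-> ->].
Qed.

(* Pósa's argument: rotations preserve the path neighbours of every vertex that
   is neither a reachable endpoint nor a neighbour of one on [p]. *)
Lemma rotated_consecutive p q (S : {set T}) u :
  (forall r x, rotated p r -> last x r \in S \/ r = [::]) ->
  rotated p q -> u \notin S ->
  (forall z, z \in S -> ~ consecutive p u z) ->
  forall y, consecutive q u y -> consecutive p u y.
Proof.
move=> inS rq uS noz; elim: rq => // q1 w z q2 rq IH ew y cons.
have zS : z \in S.
  have [|E] := inS _ z (RotatedS rq ew); last by case: q1 {rq IH cons} E.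
  by rewrite rev_cons -cats1 -cat_cons catA last_cat.
have lS : last z q2 \in S.
  have [|E] := inS _ z rq; last by case: q1 {rq IH cons} E.
  by rewrite last_cat.
have uw : u != w.
  apply/eqP => uw; apply: (noz z zS); apply: IH; rewrite uw; exists q1, q2; by left.
have {cons} : consecutive (rcons q1 w ++ rev (z :: q2)) u y by rewrite cat_rcons.
case/consecutive_cat => [[r1 [r2 H]]|/consecutive_rev [r1 [r2 H]]|].
- apply: IH; exists r1, (r2 ++ z :: q2).
  by rewrite -cat_rcons; case: H => ->; [left|right]; rewrite -catA.
- apply: IH; exists (rcons q1 w ++ r1), r2.
  by rewrite -cat_rcons; case: H => ->; [left|right]; rewrite catA.
(* The only new pair of path neighbours is [w] with the old last vertex, and [u] is neither:
   [u != w], and the old last vertex lies in [S]. *)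
case=> r1 [r2 [c [d [/rcons_inj [_ wc] Er [[uc _]|[ud _]]]]]].
  by rewrite uc -wc eqxx in uw.
have Ed : d = last z q2 by rewrite -[LHS]/(head z (d :: r2)) -Er lastI rev_rcons.
by rewrite ud Ed lS in uS.
Qed.

Definition maximal_path (p : seq T) : Prop :=
  [/\ uniq p, sorted e p &
      forall q, uniq q -> sorted e q -> size q <= size p].

(** The path neighbours of a vertex are values of two functions of it, so those of a set are covered
    by two images of the set. *)
Lemma consecutive_nth x0 p a b : uniq p -> consecutive p a b ->
  b = nth x0 p (index a p).+1 \/ b = nth x0 p (index a p).-1.
Proof.
have idx (c : T) r1 r2 : uniq (r1 ++ c :: r2) -> index c (r1 ++ c :: r2) = size r1.
  by rewrite cat_uniq /= index_cat => /and3P[_ /norP[/negPf -> _] _]; rewrite /= eqxx addn0.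
move=> up [q1 [q2 [] E]]; [left|right]; rewrite E in up *.
  by rewrite idx // nth_cat ltnNge leqnSn subSnn.
rewrite -cat_rcons in up *; rewrite idx // size_rcons /= nth_cat size_rcons leqnn.
by rewrite nth_rcons ltnn eqxx.
Qed.

(** Let [S] consist of all endpoints reachable by rotations. Every neighbour of [S] outside [S] is a
    path neighbour of [S] on the original path, so the closed neighbourhood has at most [3 * #|S|]
    vertices, and expansion forces [k < #|S|]. *)
Lemma posa_endpoints k x s :
  (forall A : {set T}, 0 < #|A| <= k -> 3 * #|A| < #|closed_nbh A|) ->
  maximal_path (x :: s) ->
  exists2 S : {set T}, k < #|S| & forall v, v \in S ->
    exists q, [/\ maximal_path q, q =i x :: s, head x q = x & last x q = v].
Proof.
move=> expand [up sp maxp]; set p := x :: s in up sp maxp.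
pose S := [set v | `[< exists2 q, rotated p q & last x q = v >]].
have SP v : v \in S -> exists2 q, rotated p q & last x q = v.
  by rewrite inE => /asboolP.
have rotS r y : rotated p r -> last y r \in S \/ r = [::].
  move=> rr; case: r rr => [|c r] rr; [by right|left].
  by rewrite inE; apply/asboolP; exists (c :: r).
exists S => [|v /SP [q rq lq]]; last first.
  have pq := rotated_perm rq.
  exists q; split=> //; last by rewrite (rotated_head _ rq).
    split; [by rewrite (perm_uniq pq)|exact: rotated_sorted rq|].
    by move=> r ur sr; rewrite (perm_size pq) maxp.
  exact: perm_mem.
rewrite ltnNge; apply/negP => Sk.
have S0 : 0 < #|S|.
  rewrite card_gt0; apply/set0Pn; exists (last x p).
  by case: (rotS p x (Rotated0 _)).
have := expand S; rewrite S0 Sk => /(_ isT); apply/negP; rewrite -leqNgt.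
pose fN (a : T) := nth x p (index a p).+1; pose fP (a : T) := nth x p (index a p).-1.
have sub : closed_nbh S \subset S :|: (fN @: S :|: fP @: S).
  rewrite subUset subsetUl /=; apply/subsetP => u; rewrite inE => /exists_inP [v vS evu].
  rewrite inE; case: (boolP (u \in S)) => //= uS.
  suff [z zS cz] : exists2 z, z \in S & consecutive p u z.
    case: (consecutive_nth x up (consecutive_sym cz)) => ->; rewrite inE.
      by apply/orP; left; apply/imsetP; exists z.
    by apply/orP; right; apply/imsetP; exists z.
  (* Otherwise [u] keeps its path neighbours under rotations, so its successor on [q] is also its
     neighbour on [p]. But rotating [q] at [u] makes that successor an endpoint, hence a member of
     [S]. *)
  apply: contrapT => noz.
  have nocons z : z \in S -> ~ consecutive p u z by move=> zS cz; apply: noz; exists z.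
  have [q rq lq] := SP v vS; have pq := rotated_perm rq.
  have uq : uniq q by rewrite (perm_uniq pq).
  have sq := rotated_sorted sp rq.
  have qu : u \in q.
    apply: contraT => uq'.
    have := maxp (rcons q u); rewrite rcons_uniq uq' uq size_rcons (perm_size pq) ltnn.
    apply=> //; case: q lq sq {rq pq uq uq'} => //= c r lq pr.
    by rewrite rcons_path pr lq.
  case/splitPr: qu lq rq uq {sq pq} => q1 q2 lq rq uq.
  case: q2 => [|z q2] in lq rq uq *.
    by rewrite last_cat /= in lq; rewrite lq vS in uS.
  have ezu : e (last z q2) u by rewrite last_cat /= in lq; rewrite lq.
  have zS : z \in S.
    have [|E] := rotS _ z (RotatedS rq ezu); last by case: (q1) E.
    by rewrite rev_cons -cats1 -cat_cons catA last_cat.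
  apply: (nocons z zS); apply: (rotated_consecutive (S := S) rotS rq uS nocons).
  by exists q1, q2; left.
apply: leq_trans (subset_leq_card sub) _.
have := leq_imset_card fN S; have := leq_imset_card fP S.
have := leq_card_setU S (fN @: S :|: fP @: S); have := leq_card_setU (fN @: S) (fP @: S).
move=> [le1 _] [le2 _]; lia.
Qed.

Lemma maximal_path_rev p : maximal_path p -> maximal_path (rev p).
Proof.
case=> up sp mp; split; first by rewrite rev_uniq.
  by rewrite sorted_rev_sym.
by move=> q uq sq; rewrite size_rev mp.
Qed.

(** Rotations with the first vertex fixed give more than [k] endpoints [v]. Reversing each path
    obtained and rotating with [v] fixed gives more than [k] endpoints again, hence at least [k]
    different from [v]. *)
Lemma posa_pairs k p :
  (forall A : {set T}, 0 < #|A| <= k -> 3 * #|A| < #|closed_nbh A|) ->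
  p != [::] -> maximal_path p ->
  exists2 Z : {set T * T}, k * k <= #|Z| & forall v, v \in Z ->
    v.1 != v.2 /\ exists s, [/\ maximal_path (v.1 :: s), v.1 :: s =i p & last v.1 s = v.2].
Proof.
move=> expand; case: p => // x s _ mp.
have [S kS SP] := posa_endpoints expand mp.
have TP v : exists F : {set T}, v \in S -> k <= #|F| /\ forall t, t \in F ->
    v != t /\ exists r, [/\ maximal_path (v :: r), v :: r =i x :: s & last v r = t].
  case: (boolP (v \in S)) => [vS|vS]; last by exists set0.
  have [q [mq eq hq lq]] := SP v vS.
  have mrq := maximal_path_rev mq.
  have [s' Es'] : exists s', rev q = v :: s'.
    case/lastP: q lq eq {mq mrq hq} => [|q c] lq eq.
      by have := eq x; rewrite mem_head.
    by rewrite rev_rcons; rewrite last_rcons in lq; rewrite lq; exists (rev q).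
  rewrite Es' in mrq; have [F kF FP] := posa_endpoints expand mrq.
  exists (F :\ v) => _; split.
    by have := cardsD1 v F; case: (v \in F) => /=; lia.
  move=> t; rewrite !inE => /andP[tv /FP [[|c r] [mr er hr lr]]].
    by have := er v; rewrite mem_head.
  rewrite /= in hr; subst c; rewrite eq_sym; split=> //; exists r; split=> //.
  by move=> y; rewrite er -Es' mem_rev eq.
have [F FP] := choice TP.
exists [set v : T * T | (v.1 \in S) && (v.2 \in F v.1)]; last first.
  by move=> v; rewrite inE => /andP[v1 v2]; have [_ /(_ _ v2)] := FP _ v1.
rewrite -sum1_card (eq_bigl (fun v : T * T => (v.1 \in S) && (v.2 \in F v.1))).
  rewrite -(pair_big_dep (fun v => v \in S) (fun v t => t \in F v) (fun _ _ => 1)) /=.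
  under eq_bigr do rewrite sum1_card.
  apply: (@leq_trans (\sum_(v in S) k)); first by rewrite sum_nat_const leq_mul2r ltnW ?orbT.
  by apply: leq_sum => v vS; have [] := FP v vS.
by move=> v; rewrite inE.
Qed.

End Rotations.

(** The closed path is a cycle, which can be opened at [a] and prolonged by [b]. *)
Lemma closing_edge_extends (T : finType) (e e' : rel T) v s a b :
  subrel e e' -> uniq (v :: s) -> path e v s -> e' (last v s) v ->
  a \in v :: s -> b \notin v :: s -> e' b a ->
  exists q, [/\ uniq q, sorted e' q & size q = (size s).+2].
Proof.
move=> sub us ps ev av bv eba.
have cy : cycle e' (v :: s) by rewrite /= rcons_path ev andbT (sub_path sub).
have [i r E] := rot_to av.
exists (b :: a :: r); split.
- by rewrite -E cons_uniq mem_rot bv rot_uniq.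
- by move: cy; rewrite -(rot_cycle i) E /= rcons_path eba => /andP[].
- by rewrite -E /= size_rot.
Qed.

(** * Sparse expanders and boosters *)

Lemma leq_card_bigcup (I T : finType) (P : pred I) (F : I -> {set T}) :
  #|\bigcup_(i | P i) F i| <= \sum_(i | P i) #|F i|.
Proof.
elim/big_rec2: _ => [|i m U _ leU]; first by rewrite cards0.
by rewrite (leq_trans (leq_card_setU _ _)) // leq_add2l.
Qed.

Lemma exists_subset_card (T : finType) (A : {set T}) k :
  k <= #|A| -> exists2 B : {set T}, B \subset A & #|B| = k.
Proof.
rewrite -bin_gt0 -cards_draws card_gt0 => /set0Pn [B].
by rewrite inE => /andP[sB /eqP]; exists B.
Qed.

Section Graphs.
Variable n : nat.
Implicit Types (G M : graph n) (A B : {set 'I_n}).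

Lemma adj_sym G : symmetric (adj G).
Proof. by move=> x y; rewrite /adj /= eq_sym setUC. Qed.

Lemma adj_sub G G' : G \subset G' -> subrel (adj G) (adj G').
Proof. by move=> /subsetP sG x y /andP[xy /sG xyG]; rewrite /adj /= xy. Qed.

Lemma edge_Kn x y : x != y -> [set x; y] \in Kn_edges n.
Proof. by move=> xy; rewrite inE cards2 xy. Qed.

(* The factor 4 bounds the number of ordered pairs inside an edge, diagonal
   included. *)
Lemma card_ordered_pairs G : G \subset Kn_edges n ->
  #|[set p : 'I_n * 'I_n | [set p.1; p.2] \in G]| <= 4 * #|G|.
Proof.
move=> /subsetP GK.
have sub : [set p : 'I_n * 'I_n | [set p.1; p.2] \in G] \subset
    \bigcup_(f in G) setX f f.
  apply/subsetP => p; rewrite inE => pG; apply/bigcupP; exists [set p.1; p.2] => //.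
  by case: p {pG} => a b; rewrite inE /= set21 set22.
apply: leq_trans (subset_leq_card sub) _.
apply: leq_trans (leq_card_bigcup _ _) _.
rewrite -sum1_card big_distrr /=; apply: leq_sum => f /GK; rewrite inE cardsX => /eqP ->.
by [].
Qed.

Lemma card_Kn_edges : #|Kn_edges n| <= n * n.
Proof.
have sub : Kn_edges n \subset [set [set p.1; p.2] | p : 'I_n * 'I_n].
  apply/subsetP => f; rewrite inE => /cards2P [x [y [_ ->]]].
  by apply/imsetP; exists (x, y).
by apply: leq_trans (subset_leq_card sub) _; rewrite (leq_trans (leq_imset_card _ _)) // card_prod !card_ord.
Qed.

Definition edges_between A B : graph n :=
  [set f | [exists x in A, exists y in B, (x != y) && (f == [set x; y])]].

Lemma edges_betweenP A B f :
  reflect (exists x y, [/\ x \in A, y \in B, x != y & f = [set x; y]])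
          (f \in edges_between A B).
Proof.
rewrite inE; apply: (iffP exists_inP).
  by case=> x xA /exists_inP [y yB /andP[xy /eqP ->]]; exists x, y.
by case=> x [y [xA yB xy ->]]; exists x => //; apply/exists_inP; exists y => //; rewrite xy /=.
Qed.

Lemma edges_between_Kn A B : edges_between A B \subset Kn_edges n.
Proof. by apply/subsetP => f /edges_betweenP [x [y [_ _ xy ->]]]; exact: edge_Kn. Qed.

Lemma card_edges_between A B : [disjoint A & B] ->
  #|A| * #|B| <= 4 * #|edges_between A B|.
Proof.
move=> dAB; apply: leq_trans (card_ordered_pairs (edges_between_Kn A B)).
rewrite -cardsX; apply: subset_leq_card; apply/subsetP => -[x y].
rewrite !inE /= => /andP[xA yB]; apply/exists_inP; exists x => //.
apply/exists_inP; exists y => //; rewrite eqxx andbT.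
by apply: contraTneq yB => <-; rewrite (disjointFr dAB).
Qed.

Lemma adj_of_hit G A B : ~~ [disjoint G & edges_between A B] ->
  exists x y, [/\ x \in A, y \in B & adj G x y].
Proof.
case/pred0Pn => f /andP[/= fG /edges_betweenP [x [y [xA yB xy Ef]]]].
by exists x, y; split=> //; rewrite /adj /= xy -Ef.
Qed.

Lemma closed_nbhS G G' A : G \subset G' ->
  closed_nbh (adj G) A \subset closed_nbh (adj G') A.
Proof.
move=> sG; apply: setUS; apply/subsetP => u; rewrite !inE => /exists_inP [v vA evu].
by apply/exists_inP; exists v => //; exact: adj_sub evu.
Qed.

Definition unjoined (k : nat) G : {set {set 'I_n} * {set 'I_n}} :=
  [set P : {set 'I_n} * {set 'I_n} | [&& #|P.1| == k, #|P.2| == k, [disjoint P.1 & P.2] &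
            [disjoint G & edges_between P.1 P.2]]].

Definition hit_by (k : nat) G (f : {set 'I_n}) :=
  [set P in unjoined k G | f \in edges_between P.1 P.2].

Definition joining_edges (k q : nat) G : graph n :=
  [set f in Kn_edges n | #|unjoined k G| <= q * #|hit_by k G f|].

(** Double counting of the unjoined pairs and the edges joining them. Each of the [N] pairs has at
    least [k^2 / 4] such edges. Edges outside [joining_edges] account for at most
    [n^2 N / q <= k^2 N / 8], half of the total, and each edge inside for at most [N]. *)
Lemma card_joining_edges k q G : 0 < q -> unjoined k G != set0 ->
  8 * (n * n) <= q * (k * k) -> k * k <= 8 * #|joining_edges k q G|.
Proof.
move=> q0; rewrite -card_gt0; set N := #|_| => N0 hq.
have count : N * (k * k) <= 4 * \sum_(f in Kn_edges n) #|hit_by k G f|.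
  have -> : \sum_(f in Kn_edges n) #|hit_by k G f| =
            \sum_(P in unjoined k G) #|edges_between P.1 P.2|.
    under eq_bigr => f _ do rewrite -sum1_card.
    under [RHS]eq_bigr => P _ do rewrite -sum1_card.
    rewrite (exchange_big_dep (fun P => P \in unjoined k G)) /=; last first.
      by move=> f P _; rewrite inE => /andP[].
    apply: eq_bigr => P PU; apply: eq_bigl => f; rewrite [P \in hit_by _ _ _]in_set PU /=.
    by case: (boolP (f \in edges_between _ _)) => [/(subsetP (edges_between_Kn _ _)) ->|]; rewrite ?andbF.
  rewrite big_distrr /=.
  apply: (@leq_trans (\sum_(P in unjoined k G) k * k)); first by rewrite sum_nat_const.
  apply: leq_sum => P; rewrite inE => /and4P[/eqP E1 /eqP E2 dP _].
  by rewrite -{1}E1 -E2 card_edges_between.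
set X := joining_edges k q G.
have split_sum : q * \sum_(f in Kn_edges n) #|hit_by k G f| <= q * (#|X| * N) + n * n * N.
  rewrite (bigID (mem X)) /= mulnDr leq_add //.
    rewrite leq_mul2l; apply/orP; right.
    apply: (@leq_trans (\sum_(f in X) N)); last by rewrite sum_nat_const.
    rewrite [leqLHS](eq_bigl (fun f => f \in X)) => [|f]; last by rewrite /= [f \in X]inE; case: (_ \in _).
    by apply: leq_sum => f _; apply: subset_leq_card; apply/subsetP => P; rewrite inE => /andP[].
  rewrite big_distrr /=; apply: (@leq_trans (\sum_(f in Kn_edges n) N)).
    rewrite [leqRHS](bigID (mem X)) /=; apply: leq_trans (leq_addl _ _).
    apply: leq_sum => f /andP[fK]; rewrite !inE; rewrite inE in fK; rewrite fK /=.
    by rewrite -ltnNge => /ltnW.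
  by rewrite sum_nat_const leq_mul2r card_Kn_edges orbT.
have : N * (q * (k * k)) <= N * (4 * (q * #|X|) + 4 * (n * n)).
  have := leq_mul (leqnn q) count; have := leq_mul (leqnn 4) split_sum; nia.
rewrite leq_pmul2l // => le1.
have : q * (k * k) <= q * (8 * #|X|) by nia.
by rewrite leq_pmul2l.
Qed.

Lemma unjoinedU k G f :
  unjoined k (f |: G) \subset unjoined k G :\: hit_by k G f.
Proof.
apply/subsetP => P; rewrite !inE => /and4P[-> -> -> dj] /=.
have dG : [disjoint G & edges_between P.1 P.2].
  by apply: disjointWl dj; apply: subsetUr.
rewrite dG /= andbT; apply/negP => fP.
by have /(_ f) := disjointFr dj; rewrite setU11 inE fP => /(_ isT).
Qed.

End Graphs.

(** Bernoulli's inequality [(1 + 1/p)^j >= 1 + j/p] with denominators cleared. *)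
Lemma bernoulli_nat p j : p ^ j * (p + j) <= p.+1 ^ j * p.
Proof.
elim: j => [|j IH]; first by rewrite !expn0 addn0.
rewrite !expnS -mulnA [p * _]mulnC.
have := leq_mul (leqnn p.+1) IH; nia.
Qed.

Lemma halving_power p : 2 * p ^ p.+1 <= p.+1 ^ p.+1.
Proof.
case: p => [|p] //; have := bernoulli_nat p.+1 p.+2.
set a := _ ^ _; set b := _ ^ _ => le.
have : p.+1 * (2 * a) <= p.+1 * b by nia.
by rewrite leq_pmul2l.
Qed.

(** * Sparse expanders inside a graph that hits the required families *)

Section SparseSubgraph.
Variables (n k p s : nat) (M : graph n).
Local Notation q := p.+1.
Hypothesis k_gt0 : 0 < k.
Hypothesis k20 : 20 * k <= n.
Hypothesis q_large : 8 * (n * n) <= q * (k * k).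
Hypothesis s_large : q * (2 * n + 1) + 8 * k + n <= s.
Hypothesis M_Kn : M \subset Kn_edges n.
Hypothesis hit_joining : forall G : graph n, G \subset Kn_edges n -> #|G| <= s ->
  k * k <= 8 * #|joining_edges k q G| -> ~~ [disjoint M & joining_edges k q G].

Let p_gt0 : 0 < p.
Proof. by rewrite lt0n; apply/eqP => p0; move: q_large; rewrite p0; nia. Qed.

(** Greedy choice: there are at most [4^n] pairs at the start, and as long as some remain, [M]
    contains an edge joining a fraction [1/q] of them; adding it multiplies their number by at most
    [p/q]. *)
Lemma sparse_unjoined_decay t : t <= s ->
  exists2 G : graph n, G \subset M /\ #|G| <= t &
    #|unjoined k G| * q ^ t <= 4 ^ n * p ^ t.
Proof.
elim: t => [|t IH] ts.
  exists set0; first by rewrite sub0set cards0.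
  have cs : #|{set 'I_n}| = 2 ^ n.
    by rewrite -cardsT -powersetT card_powerset cardsT card_ord.
  by rewrite !expn0 !muln1 (leq_trans (max_card _)) // card_prod !cs -expnMn.
have [G [GM Gt] dec] := IH (ltnW ts).
case: (eqVneq (unjoined k G) set0) => [U0|UN].
  exists G; first by split=> //; apply: leqW.
  by rewrite U0 cards0.
have hit := hit_joining (subset_trans GM M_Kn) (leq_trans Gt (ltnW ts))
  (card_joining_edges (ltn0Sn p) UN q_large).
case/pred0Pn: hit => f /andP[/= fM]; rewrite inE => /andP[_ fhit].
exists (f |: G).
  split; first by rewrite subUset sub1set fM.
  by rewrite cardsU1 -add1n leq_add // leq_b1.
have le1 := subset_leq_card (unjoinedU k G f).
have sub : hit_by k G f \subset unjoined k G by apply/subsetP => P; rewrite inE => /andP[].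
have := cardsD (unjoined k G) (hit_by k G f); rewrite (setIidPr sub) => cD.
have le2 := subset_leq_card sub.
move: le1; rewrite cD; move: fhit le2 dec.
set u := #|unjoined k G|; set h := #|hit_by _ _ _|; set u' := #|unjoined _ _|.
rewrite !expnS; set a := _ ^ t; set b := p ^ t; set c := 4 ^ n => fhit le2 dec le1.
have le3 : u' * q <= u * p by nia.
apply: (@leq_trans (u * p * a)); first by rewrite mulnA leq_mul2r le3 orbT.
by rewrite [leqLHS]mulnAC [leqLHS]mulnC [leqRHS]mulnCA leq_mul2l dec orbT.
Qed.

(** By [halving_power], every [q] steps at least halve the bound; [2n + 1] halvings bring [4^n]
    below 1. *)
Lemma sparse_joined : exists2 G : graph n, G \subset M /\ #|G| <= q * (2 * n + 1) &
  unjoined k G = set0.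
Proof.
have ts : q * (2 * n + 1) <= s by lia.
have [G GM dec] := sparse_unjoined_decay ts; exists G => //; apply/eqP.
rewrite -cards_eq0 -leqn0 -ltnS ltnNge; apply/negP => ge1.
have lt1 : 4 ^ n * p ^ (q * (2 * n + 1)) < q ^ (q * (2 * n + 1)).
  rewrite !expnM.
  have : 2 ^ (2 * n + 1) * (p ^ q) ^ (2 * n + 1) <= (q ^ q) ^ (2 * n + 1).
    by rewrite -expnMn leq_exp2r ?halving_power // addn1.
  apply: leq_trans; rewrite ltn_pmul2r ?expn_gt0 ?p_gt0 //.
  by rewrite expnD expnM expn1 -[X in X < _]muln1 ltn_pmul2l // expn_gt0.
have := leq_ltn_trans dec lt1.
rewrite ltnNge leq_pmull //.
Qed.

Hypothesis hit_cut : forall A B : {set 'I_n}, 0 < #|A| <= k -> #|B| <= 8 * #|A| ->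
  ~~ [disjoint M & edges_between A (~: (A :|: B))].

Definition joined (G : graph n) := forall A B : {set 'I_n},
  [disjoint A & B] -> k <= #|A| -> k <= #|B| -> exists x y, [/\ x \in A, y \in B & adj G x y].

Lemma unjoined0P (G : graph n) : unjoined k G = set0 -> joined G.
Proof.
move=> U0 A B dAB kA kB.
have [A' sA cA] := exists_subset_card kA; have [B' sB cB] := exists_subset_card kB.
have : (A', B') \notin unjoined k G by rewrite U0 inE.
rewrite inE /= cA cB !eqxx /=.
have -> /= : [disjoint A' & B'] by rewrite (disjointWl sA) // (disjointWr sB).
case/adj_of_hit => x [y [xA yB exy]]; exists x, y; split=> //.
  exact: (subsetP sA).
exact: (subsetP sB).
Qed.

Definition expanding (G : graph n) := forall A : {set 'I_n},
  0 < #|A| <= k -> 3 * #|A| < #|closed_nbh (adj G) A|.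

(* Two disjoint poorly expanding sets have a poorly expanding union, and by
   [joined] no poorly expanding set has size between [k] and [2k]; hence a
   maximal one absorbs all the others. *)
Lemma expanding_off_small_set (G : graph n) : joined G ->
  exists2 U : {set 'I_n}, #|U| <= k & forall A : {set 'I_n},
    [disjoint A & U] -> #|A| <= k -> 5 * #|A| <= #|closed_nbh (adj G) A|.
Proof.
move=> jG; pose cl (A : {set 'I_n}) := closed_nbh (adj G) A.
pose bad (A : {set 'I_n}) := (#|A| <= k) && (#|cl A| <= 5 * #|A|).
have bad0 : bad set0.
  rewrite /bad cards0 leqn0 cards_eq0 /=; apply/eqP/setP => u; rewrite !inE.
  by apply/exists_inP => -[v]; rewrite inE.
case: (arg_maxnP (fun A : {set 'I_n} => #|A|) bad0) => U /andP[Uk badU] maxU.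
exists U => // A dAU Ak; rewrite leqNgt; apply/negP => ltA; have badA := ltnW ltA.
have clU : cl (A :|: U) \subset cl A :|: cl U.
  apply/subsetP => u; rewrite !inE => /orP[/orP[->|->]|]; rewrite ?orbT //.
  case/exists_inP => v; rewrite inE => /orP[] vA evu; apply/orP; [left|right].
    by apply/orP; right; apply/exists_inP; exists v.
  by apply/orP; right; apply/exists_inP; exists v.
have cU : #|A :|: U| = #|A| + #|U| by apply/eqP; rewrite (leq_card_setU A U).2.
have badAU : #|cl (A :|: U)| <= 5 * #|A :|: U|.
  apply: leq_trans (subset_leq_card clU) _; apply: leq_trans (leq_card_setU _ _).1 _.
  by rewrite cU mulnDr leq_add.
(* The union has at most [2k] vertices, so its closed neighbourhood has at most [10k]. Since
   [20k <= n], at least [k] vertices lie outside it, and [jG] would give an edge to them. *)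
have small : #|A :|: U| < k.
  rewrite ltnNge; apply/negP => kAU.
  have d : [disjoint A :|: U & ~: cl (A :|: U)].
    by rewrite -setI_eq0 -setDE setD_eq0 subsetUl.
  have : k <= #|~: cl (A :|: U)|.
    have := cardsC (cl (A :|: U)); rewrite card_ord; lia.
  case/(jG _ _ d kAU) => x [y [xA]]; rewrite !inE => /negP yc exy.
  by apply: yc; apply/orP; right; apply/exists_inP; exists x.
have := maxU (A :|: U); rewrite /bad (ltnW small) badAU => /(_ isT).
by rewrite cU => le; lia.
Qed.

(** Only sets meeting the exceptional set [U] may expand badly in [G0]. Hall's theorem, applied to
    eight copies of each vertex of [U], yields disjoint stars in [M] with eight leaves each, at a
    cost of at most [8k] edges. *)
Lemma sparse_expander : exists2 G : graph n,
  G \subset M /\ #|G| <= q * (2 * n + 1) + 8 * k & joined G /\ expanding G.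
Proof.
have [G0 [G0M cG0] /unjoined0P jG0] := sparse_joined.
have [U Uk expU] := expanding_off_small_set jG0.
pose NM (v : 'I_n) := [set u | adj M v u].
have [|f finj fN] := @hall_matching ({v | v \in U} * 'I_8)%type 'I_n (fun a => NM (val a.1)).
  move=> A; pose P := [set val a.1 | a in A].
  have PU : P \subset U by apply/subsetP => _ /imsetP [a _ ->]; exact: valP.
  have [->|[a aA]] := set_0Vmem A; first by rewrite cards0.
  have cP : 0 < #|P| <= k.
    rewrite (leq_trans (subset_leq_card PU)) // andbT card_gt0.
    by apply/set0Pn; exists (val a.1); apply: imset_f.
  apply: (@leq_trans (8 * #|P|)).
    have : #|A| <= #|setX P [set: 'I_8]|.
      rewrite -(card_in_imset (f := fun a : {v | v \in U} * 'I_8 => (val a.1, a.2))).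
        apply: subset_leq_card; apply/subsetP => _ /imsetP [c cA ->].
        by rewrite !inE andbT; apply: imset_f.
      by move=> [c i] [d j] _ _ /= [/val_inj -> ->].
    by rewrite cardsX cardsT card_ord mulnC.
  (* Otherwise the [M]-neighbourhood of [P] could serve as [B] in [hit_cut], although no edge of [M]
     leads from [P] to the vertices outside both. *)
  rewrite leqNgt; apply/negP => ltN.
  have /adj_of_hit [x [y [xP]]] := hit_cut cP (ltnW ltN).
  rewrite !inE negb_or => /andP[_ /negP yN] exy; apply: yN.
  by case/imsetP: xP => c cA Ex; apply/bigcupP; exists c; rewrite // inE -Ex.
pose St := [set [set val a.1; f a] | a : {v | v \in U} * 'I_8].
have adjSt a : adj (G0 :|: St) (val a.1) (f a).
  have := fN a; rewrite inE => /andP[na _]; rewrite /adj /= na inE; apply/orP; right.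
  exact: imset_f.
exists (G0 :|: St).
  split.
    rewrite subUset G0M; apply/subsetP => _ /imsetP [a _ ->].
    by have := fN a; rewrite inE => /andP[].
  apply: leq_trans (leq_card_setU _ _) _; rewrite leq_add //.
  apply: leq_trans (leq_imset_card _ _) _; rewrite card_prod card_ord card_sig mulnC.
  by rewrite leq_mul2l.
split.
  move=> A B dAB kA kB; have [x [y [xA yB exy]]] := jG0 A B dAB kA kB.
  by exists x, y; split=> //; apply: adj_sub exy; exact: subsetUl.
move=> A /andP[A0 Ak]; set cl := closed_nbh _ A.
have le1 : 8 * #|A :&: U| <= #|cl|.
  pose D := [set a : {v | v \in U} * 'I_8 | val a.1 \in A].
  have cD : #|D| = #|A :&: U| * 8.
    have -> : D = setX [set v : {v | v \in U} | val v \in A] [set: 'I_8].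
      by apply/setP => a; rewrite !inE andbT.
    rewrite cardsX cardsT card_ord; congr (_ * 8).
    rewrite -(card_imset _ val_inj); apply: eq_card => v; rewrite inE.
    apply/imsetP/andP => [[w]|[vA vU]]; first by rewrite inE => wA ->; split=> //; exact: valP.
    by exists (Sub v vU); rewrite ?inE SubK.
  rewrite mulnC -cD -(card_imset _ finj); apply: subset_leq_card.
  apply/subsetP => y /imsetP [a aA ->]; rewrite inE in aA.
  by rewrite !inE; apply/orP; right; apply/exists_inP; exists (val a.1).
have le2 : 5 * #|A :\: U| <= #|cl|.
  have d : [disjoint A :\: U & U] by rewrite -setI_eq0 setIDAC setDIl setDv setI0.
  have AUk : #|A :\: U| <= k by rewrite (leq_trans _ Ak) // subset_leq_card // subsetDl.
  apply: leq_trans (expU _ d AUk) _; apply: leq_trans (subset_leq_card (closed_nbhS _ (subsetUl G0 St))) _.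
  apply: subset_leq_card; apply/subsetP => u; rewrite !inE => /orP[/andP[_ ->] //|].
  case/exists_inP => v; rewrite inE => /andP[_ vA] evu; apply/orP; right.
  by apply/exists_inP; exists v.
(* With [c] the size of the closed neighbourhood, [3 * #|A| <= (3/8 + 3/5) c < c]. *)
have := cardsID U A; move: le1 le2 A0; rewrite -/cl; move: #|cl| #|A :&: U| #|A :\: U| #|A| => c a b A1; lia.
Qed.


(** * Longest paths and boosters *)

Definition has_path (G : graph n) (l : nat) : bool :=
  [exists t : l.-tuple 'I_n, uniq t && sorted (adj G) t].

Lemma has_pathP G l :
  reflect (exists q, [/\ uniq q, sorted (adj G) q & size q = l]) (has_path G l).
Proof.
apply: (iffP existsP) => [[t /andP[ut st]]|[q [uq sq /eqP szq]]].
  by exists t; rewrite size_tuple.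
by exists (Tuple szq); rewrite uq.
Qed.

Lemma has_path_leq G l l' : l' <= l -> has_path G l -> has_path G l'.
Proof.
move=> ll /has_pathP [q [uq sq sz]]; apply/has_pathP; exists (take l' q).
by rewrite take_uniq // take_sorted // size_takel // sz.
Qed.

(** Since [has_path] passes to shorter lengths, a witness [l] exceeds the length of every path of
    [G]: these are the edges lengthening its longest paths. *)
Definition boosters (G : graph n) : graph n :=
  [set f in Kn_edges n |
    [exists l : 'I_n.+1, ~~ has_path G l && has_path (f |: G) l]].

(** If [A] or its complement has at most [k] vertices, expansion of that side gives the edge;
    otherwise both are large enough for [joined]. *)
Lemma leaving_edge G (A : {set 'I_n}) : joined G -> expanding G ->
  0 < #|A| < n -> exists x y, [/\ x \in A, y \notin A & adj G x y].
Proof.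
have small (B : {set 'I_n}) : expanding G -> 0 < #|B| <= k ->
    exists x y, [/\ x \in B, y \notin B & adj G x y].
  move=> eG B0k; have lt := eG B B0k.
  have /subsetPn [y] : ~~ (closed_nbh (adj G) B \subset B).
    by apply/negP => /subset_leq_card /(leq_trans lt); case: #|B| => // ?; lia.
  rewrite !inE => /orP[-> //|/exists_inP [x xB exy] yB]; by exists x, y.
move=> jG eG /andP[A0 An]; have cC := cardsC A; rewrite card_ord in cC.
case: (leqP #|A| k) => [Ak|kA]; first by apply: small; rewrite // A0.
case: (leqP #|~: A| k) => [Ck|kC].
  have [|x [y [xA yA exy]]] := small (~: A) eG; first by rewrite Ck andbT; lia.
  by exists y, x; rewrite !inE negbK in xA yA *; rewrite adj_sym.
have d : [disjoint A & ~: A] by rewrite -setI_eq0 setICr.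
have [x [y [xA yA exy]]] := jG A (~: A) d (ltnW kA) (ltnW kC).
by exists x, y; rewrite inE in yA.
Qed.

(** A longest path [P] misses a vertex [y] with a neighbour on [P]. For each endpoint pair from
    [posa_pairs], the edge between the two ends closes a cycle on the vertices of [P], and opening
    it next to [y] gives a longer path. An edge comes from at most four ordered pairs. *)
Lemma card_boosters G l : joined G -> expanding G -> 0 < l < n ->
  has_path G l -> ~~ has_path G l.+1 -> k * k <= 4 * #|boosters G|.
Proof.
move=> jG eG /andP[l0 ln] /has_pathP [P [uP sP szP]] nl.
have mP : maximal_path (adj G) P.
  split=> // q uq sq; rewrite szP leqNgt; apply: contra nl => lq.
  by apply: has_path_leq lq _; apply/has_pathP; exists q.
have PN : P != [::] by rewrite -size_eq0 szP -lt0n.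
have [x [y [xP yP exy]]] : exists x y, [/\ x \in P, y \notin P & adj G x y].
  have cP : #|[set z in P]| = l by rewrite cardsE (card_uniqP uP).
  have [|x [y [xP yP exy]]] := leaving_edge (A := [set z in P]) jG eG; first by rewrite cP l0.
  by exists x, y; rewrite !inE in xP yP.
have [Z kZ ZP] := posa_pairs (adj_sym G) eG PN mP.
apply: leq_trans kZ _; apply: leq_trans (card_ordered_pairs _); last first.
  by apply/subsetP => f; rewrite inE => /andP[].
apply: subset_leq_card; apply/subsetP => -[v t] /ZP [/= vt [r [mr er lr]]].
rewrite !inE /= cards2 vt eqxx /=; apply/existsP; exists (inord l.+1).
rewrite inordK // nl /=; case: mr => ur sr _.
have sub : subrel (adj G) (adj ([set v; t] |: G)) by apply: adj_sub; exact: subsetUr.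
have [||||q [uq sq szq]] := closing_edge_extends (a := x) (b := y) sub ur sr.
- by rewrite lr /adj /= eq_sym vt !inE setUC eqxx.
- by rewrite er.
- by rewrite er.
- by apply: sub; rewrite adj_sym.
apply/has_pathP; exists q; split=> //; rewrite szq; congr _.+1; rewrite -szP.
by have /perm_size : perm_eq (v :: r) P by apply: uniq_perm.
Qed.

Hypothesis hit_boosters : forall G : graph n, G \subset Kn_edges n -> #|G| <= s ->
  k * k <= 8 * #|boosters G| -> ~~ [disjoint M & boosters G].

(** Starting from the sparse expander, boosters in [M] are added one at a time. Both expansion
    properties survive additions, and after at most [n] of them the graph still has at most [s]
    edges, so [hit_boosters] keeps applying. *)
Theorem hitting_hamiltonian : hamiltonicity_game M.
Proof.
have [G0 [G0M cG0] [jG0 eG0]] := sparse_expander.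
suff step l : l <= n -> exists2 G : graph n,
    [/\ G0 \subset G, G \subset M & #|G| <= #|G0| + l] & has_path G l.
  have [G [_ GM _] /has_pathP [q [uq sq szq]]] := step n (leqnn n).
  exists q; split=> //; case: q sq {uq szq} => //= x q.
  by apply: sub_path; exact: adj_sub.
elim: l => [_|l IH ln].
  by exists G0; [rewrite addn0|apply/has_pathP; exists [::]].
have [G [G0G GM cG] pG] := IH (ltnW ln).
case: (boolP (has_path G l.+1)) => [pG1|npG].
  by exists G => //; split=> //; rewrite addnS leqW.
case: (posnP l) => [l0|l0].
  case/negP: npG; rewrite l0; apply/has_pathP.
  by exists [:: Ordinal ln].
have jG : joined G.
  move=> A B dAB kA kB; have [x [y [xA yB exy]]] := jG0 A B dAB kA kB.
  by exists x, y; split=> //; apply: adj_sub exy.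
have eG : expanding G.
  move=> A Ak; apply: leq_trans (eG0 A Ak) _; apply: subset_leq_card.
  exact: closed_nbhS.
have cGs : #|G| <= s by lia.
have big : k * k <= 8 * #|boosters G|.
  have := card_boosters jG eG _ pG npG; rewrite l0 ln => /(_ isT); lia.
have /pred0Pn [f /andP[/= fM fB]] := hit_boosters (subset_trans GM M_Kn) cGs big.
move: fB; rewrite inE => /andP[_ /existsP [l' /andP[nl' pl']]].
exists (f |: G).
  split; first by rewrite (subset_trans G0G) // subsetUr.
    by rewrite subUset sub1set fM.
  by rewrite cardsU1 addnS -add1n leq_add // leq_b1.
apply: has_path_leq pl'; rewrite ltnNge; apply: contra nl' => le.
exact: has_path_leq le pG.
Qed.

End SparseSubgraph.

(** * Strategies from invariants, and determinacy *)

Lemma opponentK p : opponent (opponent p) = p.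
Proof. by case: p. Qed.

Lemma turn_cons n first F (h : history n) :
  turn first (F :: h) = opponent (turn first h).
Proof. by rewrite /turn /=; case: (odd _) => //=; rewrite opponentK. Qed.

Lemma wins_of_invariant (W : winning_family) n m first p
    (J : player -> position n -> Prop) :
  J first (Position set0 set0) ->
  (forall q P, J q P -> unclaimed P = set0 -> won_by W p P) ->
  (forall P, J p P -> unclaimed P <> set0 ->
     exists F, legal_move m p P F /\ J (opponent p) (claim p P F)) ->
  (forall P F, J (opponent p) P -> unclaimed P <> set0 ->
     legal_move m (opponent p) P F -> J p (claim (opponent p) P F)) ->
  wins W n m first p.
Proof.
move=> J0 Jover Jp Jopp.
have goodP P : exists F, J p P -> unclaimed P <> set0 ->
    legal_move m p P F /\ J (opponent p) (claim p P F).
  case: (pselect (J p P /\ unclaimed P <> set0)) => [[JP nU]|no].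
    by have [F FP] := Jp P JP nU; exists F.
  by exists set0 => JP nU; case: no.
have [g gP] := choice goodP.
pose s : strategy n := fun h => g (position_after first h).
have inv h : played_by m first p s h -> J (turn first h) (position_after first h).
  elim: h => [//|F h IH] [ph nover leg Fs]; rewrite turn_cons /=.
  have Jh := IH ph; have [tp|tp] : turn first h = p \/ turn first h = opponent p.
    by case: (turn first h); case: (p); auto.
    by have := gP _ _ nover; rewrite (Fs tp) tp in Jh leg * => /(_ Jh) [].
  by rewrite tp opponentK in Jh leg *; exact: Jopp.
exists s => h ph; split=> [|nover tp]; first exact: Jover (inv h ph).
by have := inv h ph; rewrite tp => Jh; have [] := gP _ Jh nover.
Qed.

Section Rounds.
Variables (n m : nat).
Implicit Type P : position n.

Lemma claim_Breaker0 P : claim Breaker P set0 = P.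
Proof. by case: P => M B; rewrite /claim /= setU0. Qed.

Lemma legal_Breaker0 P : legal_move m Breaker P set0.
Proof. by split; [exact: sub0set|exists set0 => [|e]; rewrite ?cards0 ?inE]. Qed.

(* Breaker may pass, so it is irrelevant who moves first. *)
Lemma Maker_wins_of_rounds (W : winning_family) first (I : position n -> Prop) :
  I (Position set0 set0) ->
  (forall P F, I P -> legal_move m Breaker P F ->
     let P' := claim Breaker P F in
     (unclaimed P' = set0 -> W n (maker_graph P')) /\
     (unclaimed P' <> set0 ->
        exists2 e, e \in unclaimed P' & I (claim Maker P' [set e]))) ->
  wins W n m first Maker.
Proof.
move=> I0 step.
pose J p P := match p with
  | Breaker => I P
  | Maker => exists P0 F, [/\ I P0, legal_move m Breaker P0 F & P = claim Breaker P0 F]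
  end.
have JM P : I P -> J Maker P.
  by move=> IP; exists P, set0; rewrite claim_Breaker0; split=> //; exact: legal_Breaker0.
apply: (@wins_of_invariant W n m first Maker J).
- by case: first => //; exact: JM.
- move=> q P JP U0; have [P0 [F [I0' leg EP]]] : J Maker P by case: q JP => //; exact: JM.
  by have [] := step _ _ I0' leg; rewrite -EP => /(_ U0).
- move=> P [P0 [F [IP0 leg ->]]] nU; have [_ /(_ nU) [e eU Ie]] := step _ _ IP0 leg.
  by exists [set e]; split=> //; exists e.
- by move=> P F IP _ leg; exists P, F.
Qed.

(** Here a round is a Maker move with Breaker's answer; if Breaker moves first, he passes. *)
Lemma Breaker_wins_of_rounds (W : winning_family) first (I : position n -> Prop) :
  I (Position set0 set0) ->
  (forall P, I P -> ~ W n (maker_graph P)) ->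
  (forall P e, I P -> e \in unclaimed P ->
     exists2 F, legal_move m Breaker (claim Maker P [set e]) F &
       I (claim Breaker (claim Maker P [set e]) F)) ->
  wins W n m first Breaker.
Proof.
move=> I0 IW step.
pose J p P := match p with
  | Maker => I P
  | Breaker => exists2 F, legal_move m Breaker P F & I (claim Breaker P F)
  end.
have JB P : I P -> J Breaker P.
  by move=> IP; exists set0; [exact: legal_Breaker0|rewrite claim_Breaker0].
apply: (@wins_of_invariant W n m first Breaker J).
- by case: first => //; exact: JB.
- move=> q P JP U0; suff IP : I P by exact: IW.
  case: q JP => // -[F [FU _]]; move: FU; rewrite U0 subset0 => /eqP ->.
  by rewrite claim_Breaker0.
- by move=> P [F leg IF] _; exists F.
- by move=> P F IP _ [e eU ->]; exact: step.
Qed.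

End Rounds.

(** * Monotonicity in the bias, determinacy and existence of a threshold *)

Lemma legal_move_leq n m m' p (P : position n) F :
  m' <= m -> legal_move m' p P F -> legal_move m p P F.
Proof.
by case: p => //= mm [FU [S Sm SF]]; split=> //; exists S => //; exact: leq_trans mm.
Qed.

Lemma Maker_wins_leq W n m m' first :
  m' <= m -> wins W n m first Maker -> wins W n m' first Maker.
Proof.
move=> mm [s ws]; exists s => h ph.
have {ph} : played_by m first Maker s h.
  by elim: h ph => //= F h IH [/IH ph no /(legal_move_leq mm) leg Fs].
exact: ws.
Qed.

Lemma wins_sub (W W' : winning_family) n m first p :
  (forall P : position n, won_by W p P -> won_by W' p P) ->
  wins W n m first p -> wins W' n m first p.
Proof.
by move=> sub [s ws]; exists s => h /ws [w1 w2]; split=> // /w1 /sub.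
Qed.

Section Determinacy.
Variables (W : winning_family) (n m : nat).

(** Zermelo's backward induction, with [k] bounding the number of moves still to come. *)
Fixpoint Maker_value (k : nat) (p : player) (P : position n) : Prop :=
  if k is k'.+1 then
    (unclaimed P = set0 /\ @W n (maker_graph P)) \/
    (unclaimed P <> set0 /\
      match p with
      | Maker => exists2 F, legal_move m Maker P F & Maker_value k' Breaker (claim Maker P F)
      | Breaker => forall F, legal_move m Breaker P F -> Maker_value k' Maker (claim Breaker P F)
      end)
  else @W n (maker_graph P).

(** Breaker may pass, so the number of unclaimed edges alone need not drop. Weight 2 per edge plus 1
    on Breaker's turn drops at every move. *)
Definition moves_left (p : player) (P : position n) : nat :=
  2 * #|unclaimed P| + (if p is Breaker then 1 else 0).

Lemma moves_left_claim p P F : unclaimed P <> set0 -> legal_move m p P F ->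
  moves_left (opponent p) (claim p P F) < moves_left p P.
Proof.
move=> nU; case: p => /= [[e eU ->]|[FU _]]; rewrite /moves_left /=.
  have lt : #|unclaimed (claim Maker P [set e])| < #|unclaimed P|.
    apply: proper_card; apply/properP; split.
      by apply/subsetP => f; rewrite !inE !negb_or -!andbA => /and4P[-> _ -> ->].
    by exists e => //; rewrite !inE eqxx orbT.
  rewrite addn0 addn1; apply: leq_trans (leq_mul (leqnn 2) lt).
  by rewrite mulnS add2n.
have le : #|unclaimed (claim Breaker P F)| <= #|unclaimed P|.
  by apply: subset_leq_card; apply/subsetP => f; rewrite !inE !negb_or -!andbA => /and4P[-> -> _ ->].
by rewrite addn0 addn1 ltnS leq_mul2l.
Qed.

Lemma moves_left_eq0 p P : moves_left p P <= 0 -> unclaimed P = set0.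
Proof.
by move=> le; apply/eqP; rewrite -cards_eq0; move: le; rewrite /moves_left; case: p; lia.
Qed.

Lemma determined first : wins W n m first Maker \/ wins W n m first Breaker.
Proof.
pose k0 := moves_left first (Position set0 set0 : position n).
case: (pselect (Maker_value k0 first (Position set0 set0))) => v0; [left|right].
  apply: (@wins_of_invariant W n m first Maker
    (fun p P => exists2 k, moves_left p P <= k & Maker_value k p P)); first by exists k0.
  - move=> q P [[|k] le //=]; case=> -[] //.
  - move=> P [[|k] le]; first by move/moves_left_eq0: le.
    case=> -[] // _ [F leg v] nU; exists F; split=> //; exists k => //.
    exact: leq_trans (moves_left_claim nU leg) le.
  - move=> P F [[|k] le]; first by move/moves_left_eq0: le.
    case=> -[] // _ v nU leg; exists k; last exact: v.
    exact: leq_trans (moves_left_claim nU leg) le.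
apply: (@wins_of_invariant W n m first Breaker
  (fun p P => exists2 k, moves_left p P <= k & ~ Maker_value k p P)); first by exists k0.
- by move=> q P [[|k] le //= nv] U0 w; apply: nv; left.
- move=> P [[|k] le]; first by move/moves_left_eq0: le.
  move=> nv nU; apply: contrapT => no; apply: nv; right; split=> // F leg.
  apply: contrapT => nv; apply: no; exists F; split=> //; exists k => //.
  exact: leq_trans (moves_left_claim nU leg) le.
- move=> P F [[|k] le]; first by move/moves_left_eq0: le.
  move=> nv nU leg; exists k; first exact: leq_trans (moves_left_claim nU leg) le.
  by move=> v; apply: nv; right; split=> //; exists F.
Qed.

End Determinacy.

(** The threshold is the largest bias up to [N] at which Maker wins. Monotonicity covers the biases
    below it, determinacy those between it and [N]. *)
Lemma threshold_bias_between W n first a N :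
  a <= N -> wins W n a first Maker ->
  (forall m, N < m -> wins W n m first Breaker) ->
  exists2 m0, a <= m0 <= N & threshold_bias W first n m0.
Proof.
move=> aN wa wN; pose Q i := `[< i <= N /\ wins W n i first Maker >].
have exQ : exists i, Q i by exists a; apply/asboolP.
have boundQ i : Q i -> i <= N by case/asboolP.
case: (ex_maxnP exQ boundQ) => m0 /asboolP [m0N w0] maxQ.
exists m0; first by rewrite m0N andbT; apply: maxQ; apply/asboolP.
move=> m; split=> [mm0|m0m]; first exact: Maker_wins_leq w0.
case: (leqP m N) => [mN|]; last exact: wN.
case: (determined W n m first) => // wM.
by have := maxQ m; rewrite leqNgt m0m => /(_ (asboolT (conj mN wM))).
Qed.

(** * The potential method *)

Lemma card_legal_Breaker n m (P : position n) F :
  legal_move m Breaker P F -> #|F| <= m * m.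
Proof.
case=> FU [S Sm SF].
have sub : F \subset [set [set p.1; p.2] | p in setX S S].
  apply/subsetP => e eF; have eS := subsetP (SF e eF).
  have := subsetP FU e eF; rewrite !inE => /andP[_ /cards2P [x [y [_ Ee]]]].
  apply/imsetP; exists (x, y); last by [].
  by rewrite inE /= !eS // Ee !inE eqxx ?orbT.
apply: leq_trans (subset_leq_card sub) _; apply: leq_trans (leq_imset_card _ _) _.
by rewrite cardsX leq_mul.
Qed.

Section Potential.
Local Open Scope ring_scope.
Variable b : nat.
Hypothesis b_gt0 : (0 < b)%N.

(* A rational substitute for [2 ^ (- 1 / b)]: [decay ^- j <= 1 + j / b] for [j <= b],
   while [decay ^+ (2 * b) <= 1 / 2]. *)
Definition decay : rat := (1 + (2 * b%:R)^-1)^-1.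

Let b0 : 0 < b%:R :> rat. Proof. by rewrite ltr0n. Qed.

Let lam0 : 0 < 1 + (2 * b%:R)^-1 :> rat.
Proof. by rewrite addr_gt0 // invr_gt0 mulr_gt0. Qed.

Lemma decay_gt0 : 0 < decay. Proof. by rewrite invr_gt0. Qed.

Lemma decay_le1 : decay <= 1.
Proof. by rewrite invf_le1 // lerDl invr_ge0 mulr_ge0 // ltW. Qed.

Lemma decay_growth a j : (j <= a)%N -> (j <= b)%N ->
  decay ^+ (a - j) <= decay ^+ a * (1 + j%:R / b%:R).
Proof.
move=> ja jb.
(* In the induction step, [(1 + 1/(2b)) (1 + j/b) <= 1 + (j+1)/b] amounts to [j <= b]. *)
have growth : (1 + (2 * b%:R)^-1) ^+ j <= 1 + j%:R / b%:R :> rat.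
  elim: j jb {ja} => [|j IH] jb; first by rewrite expr0 mul0r addr0.
  rewrite exprS; apply: le_trans (ler_wpM2l (ltW lam0) (IH (ltnW jb))) _.
  have jb' : j%:R <= b%:R :> rat by rewrite ler_nat ltnW.
  have le1 : (j%:R / b%:R) * b%:R^-1 <= b%:R^-1 :> rat.
    apply: ler_piMl; first by rewrite invr_ge0 ltW.
    by rewrite ler_pdivrMr // mul1r.
  rewrite invfM [X in _ <= X](_ : _ = 1 + j%:R / b%:R + b%:R^-1); last first.
    by rewrite -natr1 mulrDl mul1r addrA.
  move: le1; move: (b%:R^-1 : rat) (j%:R : rat) => y x le1; nra.
rewrite -{2}(subnK ja) exprD -mulrA; apply: ler_peMr.
  by rewrite exprn_ge0 // ltW // decay_gt0.
by rewrite /decay exprVn mulrC ler_pdivlMr ?mul1r // exprn_gt0.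
Qed.

Lemma decay_halving t c : (2 * b * t <= c)%N -> decay ^+ c <= 2^-1 ^+ t.
Proof.
move=> le; apply: (@le_trans _ _ (decay ^+ (2 * b * t))).
  by apply: ler_wiXn2l => //; [exact: ltW decay_gt0|exact: decay_le1].
rewrite exprM; apply: lerXn2r; rewrite ?nnegrE ?exprn_ge0 ?(ltW decay_gt0) ?invr_ge0 //.
rewrite /decay exprVn lef_pV2 ?posrE ?exprn_gt0 //.
have bern j : 1 + j%:R * (2 * b%:R)^-1 <= (1 + (2 * b%:R)^-1) ^+ j :> rat.
  elim: j => [|j IH]; first by rewrite mul0r addr0 expr0.
  rewrite exprS; apply: le_trans (ler_wpM2l (ltW lam0) IH); rewrite -(natr1 j).
  have x0 : 0 <= (2 * b%:R)^-1 :> rat by rewrite invr_ge0 mulr_ge0 // ltW.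
  have j0 : 0 <= j%:R :> rat by []. 
  nra.
apply: le_trans (bern _); rewrite natrM mulfV; first by lra.
by rewrite mulf_neq0 // gt_eqF.
Qed.

(** A union bound: at most [2^s] terms, each at most [2^-(s+t)]. *)
Lemma sum_decay_le (I : finType) (Q : pred I) (c : I -> nat) s t :
  (#|Q| <= 2 ^ s)%N -> (forall i, Q i -> 2 * b * (s + t) <= c i)%N ->
  \sum_(i | Q i) decay ^+ c i <= 2^-1 ^+ t.
Proof.
move=> cQ hc; apply: (@le_trans _ _ (\sum_(i | Q i) 2^-1 ^+ (s + t))).
  by apply: ler_sum => i /hc; exact: decay_halving.
rewrite sumr_const -[leLHS]mulr_natr exprD mulrAC; apply: ler_piMl.
  by apply: exprn_ge0; rewrite invr_ge0.
by rewrite exprVn mulrC ler_pdivrMr ?exprn_gt0 // mul1r -natrX ler_nat.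
Qed.

Section Hitting.
Variables (n m : nat) (I : finType) (Q : pred I) (X : I -> graph n).
Hypothesis b_large : (m * m <= b)%N.
Hypothesis X_Kn : forall i, Q i -> X i \subset Kn_edges n.

(** An Erdős-Selfridge weight with Maker as the hitting player: a set already hit weighs 0, and one
    wholly owned by Breaker weighs 1. *)
Definition weight (P : position n) (i : I) : rat :=
  if [disjoint maker_graph P & X i]
  then decay ^+ #|X i :\: breaker_graph P| else 0.

Definition potential P := \sum_(i | Q i) weight P i.

Definition danger P f := \sum_(i | Q i && (f \in X i)) weight P i.

Lemma weight_ge0 P i : 0 <= weight P i.
Proof. by rewrite /weight; case: ifP => // _; rewrite exprn_ge0 // ltW // decay_gt0. Qed.

(** Breaker takes at most [b] edges, so by [decay_growth] each weight grows at most linearly in the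
    number of its edges taken; summing over the edges instead of the sets produces the dangers. *)
Lemma potential_Breaker (P : position n) F : legal_move m Breaker P F ->
  potential (claim Breaker P F) <= potential P + b%:R^-1 * \sum_(f in F) danger P f.
Proof.
move=> leg; have Fb := leq_trans (card_legal_Breaker leg) b_large.
have FB : [disjoint F & breaker_graph P].
  apply: (disjointWl leg.1); rewrite disjoint_subset; apply/subsetP => f.
  by rewrite !inE negb_or => /andP[/andP[_ ->]].
have -> : \sum_(f in F) danger P f = \sum_(i | Q i) weight P i * #|X i :&: F|%:R.
  rewrite /danger (exchange_big_dep Q) /=; last by move=> f i _ /andP[].
  apply: eq_bigr => i Qi; rewrite sumr_const mulr_natr; congr (_ *+ _).
  by apply: eq_card => f; rewrite !inE /in_mem /= Qi /= andbC.
rewrite mulr_sumr -big_split /=; apply: ler_sum => i Qi.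
apply: (@le_trans _ _ (weight P i * (1 + #|X i :&: F|%:R / b%:R))); last first.
  by rewrite mulrDr mulr1 lerD2l mulrA [leRHS]mulrC.
rewrite /weight /=; case: ifP => d; last by rewrite mul0r.
have -> : #|X i :\: (breaker_graph P :|: F)| =
          (#|X i :\: breaker_graph P| - #|X i :&: F|)%N.
  rewrite -setDDl cardsD; congr (_ - _)%N; apply: eq_card => f; rewrite !inE.
  by case fF: (f \in F); rewrite ?andbF // (disjointFr FB fF).
apply: decay_growth.
  apply: subset_leq_card; apply/subsetP => f; rewrite !inE => /andP[-> fF].
  by rewrite (disjointFr FB fF).
by apply: leq_trans Fb; rewrite subset_leq_card // subsetIr.
Qed.

Lemma weight_Maker (P : position n) e i : weight (claim Maker P [set e]) i =
  if e \in X i then 0 else weight P i.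
Proof.
rewrite /weight /= -setI_eq0 setIUl setU_eq0 !setI_eq0 disjoints1.
by case: (e \in X i); rewrite ?andbF ?andbT.
Qed.

(** Invariant: potential plus the danger of any free edge is at most 1/2. A Breaker move adds to the
    potential at most the largest danger, so it stays at most 1/2. Maker then takes an edge of
    largest danger, which restores the invariant. A set owned by Breaker at the end would alone
    contribute 1. *)
Lemma Maker_wins_hitting (W : winning_family) first :
  \sum_(i | Q i) decay ^+ #|X i| <= 4^-1 ->
  (forall M : graph n, M \subset Kn_edges n ->
     (forall i, Q i -> ~~ [disjoint M & X i]) -> W n M) ->
  wins W n m first Maker.
Proof.
move=> small hitW.
pose J P := [/\ maker_graph P \subset Kn_edges n, potential P <= 2^-1 &
  forall f, f \in unclaimed P -> potential P + danger P f <= 2^-1].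
have danger_le P f : danger P f <= potential P.
  rewrite /danger /potential (bigID (fun i => f \in X i) Q) /= lerDl.
  by apply: sumr_ge0 => i _; exact: weight_ge0.
apply: (@Maker_wins_of_rounds n m W first J).
  have p0 : potential (Position set0 set0) <= 4^-1.
    apply: le_trans small; apply: ler_sum => i _.
    by rewrite /weight /= setD0 -setI_eq0 set0I eqxx.
  split; [exact: sub0set| |move=> f _; have := danger_le (Position set0 set0) f]; lra.
move=> P F [MK pot pot_danger] leg P'.
have pot' : potential P' <= 2^-1.
  have ib0 : 0 <= b%:R^-1 :> rat by rewrite invr_ge0 ltW.
  apply: le_trans (potential_Breaker leg) _; rewrite -lerBrDl.
  have le1 : \sum_(f in F) danger P f <= \sum_(f in F) (2^-1 - potential P).
    by apply: ler_sum => f fF; rewrite lerBrDl pot_danger // (subsetP leg.1).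
  apply: le_trans (ler_wpM2l ib0 le1) _; rewrite sumr_const -[X in _ * X]mulr_natr mulrCA.
  rewrite mulrC; apply: ler_piMl; first by rewrite subr_ge0.
  rewrite mulrC ler_pdivrMr // mul1r ler_nat.
  exact: leq_trans (card_legal_Breaker leg) b_large.
split=> [U0|nU].
  apply: hitW => // i Qi; apply/negP => d.
  have : weight P' i <= 2^-1.
    apply: le_trans pot'; rewrite /potential (bigD1 i) //= lerDl.
    by apply: sumr_ge0 => j _; exact: weight_ge0.
  rewrite /weight d; have /eqP -> : #|X i :\: breaker_graph P'| == 0%N; last by rewrite expr0; lra.
  rewrite cards_eq0 -subset0; apply/subsetP => f; rewrite !inE => /andP[fB fX].
  have fK := subsetP (X_Kn Qi) f fX.
  have : f \in unclaimed P' by rewrite !inE in fK *; rewrite negb_or fB fK (disjointFl d fX).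
  by rewrite U0 inE.
have /set0Pn [e0 e0U] : unclaimed P' != set0 by apply/eqP.
case: (arg_maxP (danger P') e0U) => e eU emax; exists e => //.
have potM : potential (claim Maker P' [set e]) = potential P' - danger P' e.
  rewrite {1}/potential (eq_bigr (fun i => if e \in X i then 0 else weight P' i)); last first.
    by move=> i _; exact: weight_Maker.
  rewrite /danger /potential [X in _ = X - _](bigID (fun i => e \in X i) Q) /=.
  rewrite addrAC subrr add0r (bigID (fun i => e \in X i) Q) /= big1 ?add0r.
    by apply: eq_bigr => i /andP[_ /negPf ->].
  by move=> i /andP[_ ->].
have danger0 f : 0 <= danger P' f by apply: sumr_ge0 => i _; exact: weight_ge0.
split.
- by rewrite /= subUset MK sub1set; have := eU : e \in unclaimed P'; rewrite in_setD => /andP[].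
- by rewrite potM; have := danger0 e; lra.
move=> f fU; rewrite potM.
have fU' : f \in unclaimed P'.
  by move: fU; rewrite !inE !negb_or -!andbA => /and4P[-> _ -> ->].
have le1 : danger (claim Maker P' [set e]) f <= danger P' f.
  by apply: ler_sum => i _; rewrite weight_Maker; case: ifP => // _; exact: weight_ge0.
have le2 : danger P' f <= danger P' e by exact: emax.
apply: le_trans pot'; rewrite -addrA gerDl addrC subr_le0; exact: le_trans le1 le2.
Qed.

End Hitting.
End Potential.

(** * Maker's strategy for a Hamiltonian path *)

Lemma card_small_subsets (T : finType) (E : {set T}) s :
  #|[set A : {set T} | (A \subset E) && (#|A| <= s)]| <= #|E|.+1 ^ s.
Proof.
elim: s => [|s IH].
  rewrite expn0 -(cards1 (set0 : {set T})); apply: subset_leq_card.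
  by apply/subsetP => A; rewrite !inE leqn0 cards_eq0 => /andP[].
set D := [set A : {set T} | _] in IH.
have sub : [set A : {set T} | (A \subset E) && (#|A| <= s.+1)] \subset
    D :|: [set x.1 |: x.2 | x in setX E D].
  apply/subsetP => A; rewrite !inE => /andP[AE As]; rewrite AE /=.
  case: (leqP #|A| s) => //= ltA; have /card_gt0P [x xA] : 0 < #|A| by apply: leq_ltn_trans ltA.
  apply/imsetP; exists (x, A :\ x); last by rewrite /= setD1K.
  rewrite !inE /= (subsetP AE) //= (subset_trans (subsetDl _ _)) //=.
  by move: As; rewrite (cardsD1 x) xA.
apply: leq_trans (subset_leq_card sub) _; apply: leq_trans (leq_card_setU _ _) _.
rewrite expnS mulSn leq_add //; apply: leq_trans (leq_imset_card _ _) _.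
by rewrite cardsX leq_mul2l IH orbT.
Qed.

(** The initial potential is at most 1/8 for the cuts plus 1/16 for each of the two families indexed
    by sparse graphs, in total 1/4. *)
Theorem Maker_wins_hamiltonicity n m k p s l first :
  0 < k -> 20 * k <= n -> 8 * (n * n) <= p.+1 * (k * k) ->
  p.+1 * (2 * n + 1) + 8 * k + n <= s -> n < 2 ^ l ->
  208 * ((m * m).+1 * l) <= n ->
  16 * ((m * m).+1 * (2 * l * s + 4)) <= k * k ->
  wins hamiltonicity_game n m first Maker.
Proof.
move=> k0 k20 pk sl nl cut_large sparse_large.
pose I := ({set 'I_n} * {set 'I_n} + (graph n + graph n))%type.
pose Q (i : I) := match i with
  | inl (A, B) => (0 < #|A| <= k) && (#|B| <= 8 * #|A|)
  | inr (inl G) => [&& G \subset Kn_edges n, #|G| <= s & k * k <= 8 * #|joining_edges k p.+1 G|]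
  | inr (inr G) => [&& G \subset Kn_edges n, #|G| <= s & k * k <= 8 * #|boosters G|]
  end.
pose X (i : I) : graph n := match i with
  | inl (A, B) => edges_between A (~: (A :|: B))
  | inr (inl G) => joining_edges k p.+1 G
  | inr (inr G) => boosters G
  end.
have l0 : 0 < l by case: l nl {cut_large sparse_large} => //; rewrite expn0; lia.
set b := (m * m).+1 in cut_large sparse_large.
have b0 : 0 < b by [].
apply: (@Maker_wins_hitting b b0 n m I Q X) => //.
- move=> [[A B]|[G|G]] _ /=; first exact: edges_between_Kn.
    by apply/subsetP => f; rewrite inE => /andP[].
  by apply/subsetP => f; rewrite inE => /andP[].
(* There are at most [(n^2 + 1)^s <= 2^(2ls)] graphs [G], each with a target set of at least
   [k^2 / 8] edges. *)
- have sparse (Y : graph n -> graph n) :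
      (\sum_(G : graph n | [&& G \subset Kn_edges n, #|G| <= s & k * k <= 8 * #|Y G|]%N)
        decay b ^+ #|Y G| <= 2^-1 ^+ 4)%R.
    apply: (@sum_decay_le b b0 _ _ _ (2 * l * s) 4).
      apply: (@leq_trans (#|Kn_edges n|.+1 ^ s)).
        apply: leq_trans (card_small_subsets _ _); apply: subset_leq_card.
        by apply/subsetP => G; rewrite !inE => /and3P[-> ->].
      rewrite expnM; case: (s) => [|s']; first by rewrite !expn0.
      rewrite leq_exp2r // mulnC expnM.
      apply: leq_trans (_ : (n * n).+1 <= _); first by rewrite ltnS card_Kn_edges.
      by move: nl; set a := 2 ^ l; rewrite expnS expn1; nia.
    by move=> G /and3P[_ _]; move: sparse_large; set t := _ + 4; nia.
  (* The cuts are grouped by [a = #|A|]. There are at most [(n+1)^(9a) <= 2^(9la)] of them, each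
     with at least [an/8 >= 26bla] edges, where [208 = 8 * 26]. As [26a >= 2 (9a + 4)], each group
     weighs at most [2^(-4l)], and there are [n + 1 <= 2^l] groups. *)
  have cut : (\sum_(i : {set 'I_n} * {set 'I_n} | Q (inl i)) decay b ^+ #|X (inl i)|
      <= 8^-1)%R.
    rewrite (partition_big (fun i : {set 'I_n} * {set 'I_n} => inord #|i.1| : 'I_n.+1) predT) //=.
    apply: (@le_trans _ _ (\sum_(a < n.+1) 2^-1 ^+ (4 * l))%R).
      apply: ler_sum => a _; case: (posnP a) => [a0|a0].
        rewrite big_pred0 ?exprn_ge0 ?invr_ge0 // => -[A B] /=.
        apply/negP => /andP[/andP[/andP[A0 _] _] /eqP /(congr1 val)].
        rewrite /= inordK ?a0 => [A00|]; first by rewrite A00 in A0.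
        by rewrite ltnS -[leqRHS]card_ord max_card.
      have sizeA (A B : {set 'I_n}) : Q (inl (A, B)) && (inord #|A| == a) ->
          [/\ #|A| = a, #|B| <= 8 * a & a <= k].
        case/andP=> /andP[/andP[_ Ak] B8] /eqP /(congr1 val) /=.
        rewrite inordK => [<- //|].
        by rewrite ltnS -[leqRHS]card_ord max_card.
      apply: (@sum_decay_le b b0 _ _ _ (9 * l * a) (4 * l)).
        pose DA := [set A : {set 'I_n} | (A \subset setT) && (#|A| <= a)].
        pose DB := [set A : {set 'I_n} | (A \subset setT) && (#|A| <= 8 * a)].
        apply: (@leq_trans #|setX DA DB|).
          apply: subset_leq_card; apply/subsetP => -[A B] /sizeA [Aa Ba _].
          by rewrite !inE /= !subsetT Aa leqnn Ba.
        rewrite cardsX; apply: leq_trans (leq_mul (card_small_subsets _ _) (card_small_subsets _ _)) _.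
        rewrite cardsT card_ord -expnD -mulSn (_ : 9 * l * a = l * (9 * a)); last by lia.
        by rewrite [leqRHS]expnM leq_exp2r // muln_gt0.
      move=> [A B] /sizeA [Aa Ba ak].
      have d : [disjoint A & ~: (A :|: B)] by rewrite -setI_eq0 setCU setIA setICr set0I.
      have := card_edges_between d; rewrite Aa /X.
      have cU := (leq_card_setU A B).1; have := cardsC (A :|: B); rewrite card_ord => cC.
      set x := #|edges_between _ _|.
      have : n - 9 * a <= #|~: (A :|: B)| by rewrite -Aa in Ba ak *; lia.
      move: #|~: _| => c hc hx.
      have : a * n <= 8 * x by nia.
      move=> hx'; have : 208 * (b * l) * a <= 8 * x by nia.
      nia.
    rewrite sumr_const card_ord -[leLHS]mulr_natr exprVn mulrC ler_pdivrMr ?exprn_gt0 //.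
    rewrite mulrC ler_pdivlMr // -!natrX -natrM ler_nat.
    have -> : 4 * l = l + 3 * l by lia.
    rewrite expnD leq_mul // (expnM 2 3) (_ : 8 = 8 ^ 1) // leq_exp2l //.
  have -> : (\sum_(i | Q i) decay b ^+ #|X i| =
     \sum_(i | Q (inl i)) decay b ^+ #|X (inl i)| +
     (\sum_(i | Q (inr (inl i))) decay b ^+ #|X (inr (inl i))| +
      \sum_(i | Q (inr (inr i))) decay b ^+ #|X (inr (inr i))|))%R.
    by rewrite !big_sumType.
  have := sparse (joining_edges k p.+1); have := sparse (@boosters n); rewrite /=.
  move: cut; rewrite exprVn; move: (\sum_(i | _) _)%R => x; lra.
move=> M MK hit; apply: (@hitting_hamiltonian n k p s M) => //.
- by move=> G GK Gs big; apply: (hit (inr (inl G))); rewrite /= GK Gs big.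
- by move=> A B Ak B8; apply: (hit (inl (A, B))); rewrite /= Ak B8.
- by move=> G GK Gs big; apply: (hit (inr (inr G))); rewrite /= GK Gs big.
Qed.

(** * The triangle game *)

Definition nbh n (G : graph n) (u : 'I_n) : {set 'I_n} := [set w | adj G u w].

Lemma nbhU n (G G' : graph n) u : nbh (G :|: G') u = nbh G u :|: nbh G' u.
Proof. by apply/setP => w; rewrite !inE /adj /= inE -andb_orr. Qed.

Lemma nbh0 n (u : 'I_n) : nbh (set0 : graph n) u = set0.
Proof. by apply/setP => w; rewrite !inE /adj /= inE andbF. Qed.

Lemma set2_inj_l (T : finType) (x y z : T) :
  [set x; y] = [set x; z] -> y = z.
Proof.
move=> E; have : y \in [set x; z] by rewrite -E set22.
have : z \in [set x; y] by rewrite E set22.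
by rewrite !inE => /orP[] /eqP -> // /orP[] /eqP.
Qed.

(** * Breaker's strategy in the triangle game *)

Section TriangleBreaker.
Variables (n m q : nat).
Hypothesis q_gt0 : 0 < q.
Hypothesis m_large : 2 + 2 * (n %/ q) + 2 * q <= m.

Definition saturated (P : position n) u :=
  forall w, w != u -> [set u; w] \notin unclaimed P.

(** The degree ratio bounds Maker's degree by [n / q] wherever a free edge remains; the last clause
    says that no threat of a triangle is open. *)
Definition triangle_guarded (P : position n) : Prop :=
  [/\ [disjoint maker_graph P & breaker_graph P],
      forall u, saturated P u \/
        q * #|nbh (maker_graph P) u| <= #|nbh (breaker_graph P) u| &
      forall x y z, adj (maker_graph P) x y -> adj (maker_graph P) x z -> y != z ->
        [set y; z] \in breaker_graph P].

Lemma triangle_guarded_not_won P : triangle_guarded P -> ~ triangle_game (maker_graph P).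
Proof.
case=> d _ guard [x [y [z [xy yz xz]]]]; case/andP: yz => nyz yzM.
by have := guard x y z xy xz nyz; rewrite (disjointFr d yzM).
Qed.

Lemma exists_block (A : {set 'I_n}) : exists2 E : {set 'I_n},
  E \subset A & (#|E| <= q) /\ (E = A \/ #|E| = q).
Proof.
case: (leqP #|A| q) => [Aq|qA]; first by exists A => //; split=> //; left.
by have [E EA Eq] := exists_subset_card (ltnW qA); exists E; rewrite ?Eq //; split=> //; right.
Qed.

(** Breaker takes all free edges inside [S]: the ends of [e], their Maker-neighbours, at most
    [n / q] for each end, and up to [q] free neighbours of each end. *)
Lemma triangle_guarded_step P e : triangle_guarded P -> e \in unclaimed P ->
  exists2 F, legal_move m Breaker (claim Maker P [set e]) F &
    triangle_guarded (claim Breaker (claim Maker P [set e]) F).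
Proof.
case: P => M B [/= dMB deg guard] eU; set P := Position M B in deg eU *.
set P1 := claim Maker P [set e].
have /cards2P [u [v [uv Ee]]] : #|e| == 2.
  by move: eU; rewrite inE => /andP[_]; rewrite inE.
have eB : e \notin B by move: eU; rewrite !inE negb_or => /andP[/andP[]].
have degM c d : c != d -> e = [set c; d] -> q * #|nbh M c| <= #|nbh B c|.
  by move=> cd Ecd; case: (deg c) => // /(_ d); rewrite eq_sym cd -Ecd eU => /(_ isT).
have degn c d : c != d -> e = [set c; d] -> #|nbh M c| <= n %/ q.
  move=> cd Ecd; rewrite leq_divRL // mulnC (leq_trans (degM c d cd Ecd)) //.
  by rewrite -[leqRHS]card_ord max_card.
pose fr c := [set w | (w != c) && ([set c; w] \in unclaimed P1)].
have [Eu sEu [Euq Eu_or]] := exists_block (fr u).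
have [Ev sEv [Evq Ev_or]] := exists_block (fr v).
pose S := [set u; v] :|: (nbh M u :|: nbh M v) :|: (Eu :|: Ev).
have Sm : #|S| <= m.
  apply: leq_trans m_large; rewrite /S.
  have vu : v != u by rewrite eq_sym. have Ee' : e = [set v; u] by rewrite setUC.
  have := degn u v uv Ee; have := degn v u vu Ee'.
  have := (leq_card_setU ([set u; v] :|: (nbh M u :|: nbh M v)) (Eu :|: Ev)).1.
  have := (leq_card_setU [set u; v] (nbh M u :|: nbh M v)).1.
  have := (leq_card_setU (nbh M u) (nbh M v)).1.
  have := (leq_card_setU Eu Ev).1; rewrite cards2 uv /=.
  move: Euq Evq; move: #|_ :|: (Eu :|: Ev)| #|[set u; v] :|: _| #|nbh M u :|: _| #|Eu :|: Ev|.
  move: #|nbh M u| #|nbh M v| #|Eu| #|Ev| => a1 a2 a3 a4 a5 a6 a7 a8; lia.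
pose F := [set f in unclaimed P1 | f \subset S].
have FP f : f \in Kn_edges n -> f \subset S -> f \in M :|: [set e] \/ f \in B :|: F.
  move=> fK fS; case: (boolP (f \in M :|: [set e])) => fM; [by left|right].
  rewrite in_setU; case: (boolP (f \in B)) => //= fB.
  by rewrite [f \in F]in_set fS andbT in_setD fK andbT in_setU negb_or fB andbT.
exists F.
  split; first by apply/subsetP => f; rewrite inE => /andP[].
  by exists S => // f; rewrite inE => /andP[].
(* At an end of [e], either Breaker takes every remaining free edge, or he gains [q] neighbours
   while Maker gains one, so the ratio persists. *)
have end_deg c d (E : {set 'I_n}) : c != d -> e = [set c; d] -> E \subset fr c -> E \subset S -> c \in S ->
    E = fr c \/ #|E| = q ->
    saturated (claim Breaker P1 F) c \/
    q * #|nbh (M :|: [set e]) c| <= #|nbh (B :|: F) c|.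
  move=> cd Ecd sE ES cS [EE|Eq].
    left=> w wc; apply/negP => cw.
    have cw1 : [set c; w] \in unclaimed P1.
      by move: cw; rewrite !inE !negb_or -!andbA => /and5P[-> -> -> _ ->].
    have wE : w \in E by rewrite EE inE wc.
    have : [set c; w] \in F.
      rewrite inE cw1 /=; apply/subsetP => y; rewrite in_set2 => /orP[] /eqP -> //.
      exact: (subsetP ES).
    by move=> cwF; move: cw; rewrite in_setD => /andP[/negP []]; rewrite !in_setU cwF !orbT.
  right; apply: (@leq_trans (q * #|nbh M c| + q)).
    rewrite nbhU -mulnSr leq_mul2l; apply/orP; right.
    apply: leq_trans (leq_card_setU _ _).1 _; rewrite -addn1 leq_add2l.
    rewrite -(cards1 d); apply: subset_leq_card; apply/subsetP => w.
    by rewrite Ecd inE => /andP[_ /set1P /set2_inj_l ->]; rewrite set11.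
  have Ed : [disjoint nbh B c & E].
    rewrite disjoint_sym disjoint_subset; apply/subsetP => w /(subsetP sE).
    rewrite inE => /andP[wc]; rewrite !inE !negb_or -!andbA => /and4P[_ _ wB _].
    by rewrite /adj /= negb_and wB orbT.
  rewrite -{2}Eq; apply: leq_trans (leq_add (degM c d cd Ecd) (leqnn _)) _.
  have <- : #|nbh B c :|: E| = #|nbh B c| + #|E| by apply/eqP; rewrite (leq_card_setU _ _).2.
  rewrite nbhU; apply: subset_leq_card; apply: setUS; apply/subsetP => w wE.
  have := subsetP sE w wE; rewrite inE => /andP[wc cw].
  rewrite inE /adj /= eq_sym wc inE cw /=; apply/subsetP => y; rewrite in_set2 => /orP[] /eqP -> //.
  exact: (subsetP ES).
split.
- rewrite /= -setI_eq0 setIUr !setIUl !setU_eq0 !setI_eq0 dMB disjoints1 eB /=.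
  rewrite -!setI_eq0 -setU_eq0 -setIUl setI_eq0 disjoint_sym disjoint_subset.
  by apply/subsetP => f; rewrite inE => /andP[]; rewrite !inE negb_or => /andP[/andP[]].
- move=> c; have [cu|cu] := eqVneq c u.
    subst c; apply: (end_deg u v Eu) => //.
      by apply/subsetP => y yE; rewrite !inE yE !orbT.
    by rewrite !inE eqxx.
  have [cv|cv] := eqVneq c v.
    subst c; apply: (end_deg v u Ev) => //.
    - by rewrite setUC.
    - by apply/subsetP => y yE; rewrite !inE yE !orbT.
    - by rewrite !inE eqxx orbT.
  case: (deg c) => [sat|le]; [left|right].
    move=> w wc; apply: contra (sat w wc).
    by rewrite !inE !negb_or -!andbA => /and5P[-> _ -> _ ->].
  rewrite /= !nbhU.
  have -> : nbh [set e] c = set0.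
    apply/setP => w; rewrite !inE; apply/negP => /andP[_ /set1P Ecw].
    have : c \in e by rewrite -Ecw set21.
    by rewrite Ee !inE (negPf cu) (negPf cv).
  by rewrite setU0 (leq_trans le) // subset_leq_card // subsetUl.
(* If Maker already owned [dz], then [c] and [d] would both be Maker-neighbours of [z], and [guard]
   would give [e] to Breaker before Maker claimed it. *)
have close c d z : c != d -> e = [set c; d] -> adj M c z -> d != z -> c \in S -> d \in S ->
    nbh M c \subset S -> [set d; z] \in B :|: F.
  move=> cd Ecd cz dz cS dS NS; case: (FP [set d; z]) => //.
  - exact: edge_Kn.
  - apply/subsetP => y; rewrite in_set2 => /orP[] /eqP -> //.
    by apply: (subsetP NS); rewrite inE.
  case/setUP => [dzM|]; last first.
    rewrite inE Ecd [in X in _ == X]setUC => /eqP /set2_inj_l zc.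
    by case/andP: cz; rewrite zc eqxx.
  have zc : adj M z c by rewrite adj_sym.
  have zd : adj M z d by rewrite adj_sym /adj /= dz.
  by have := guard z c d zc zd cd; rewrite -Ecd (negPf eB).
have uS : u \in S by rewrite !inE eqxx.
have vS : v \in S by rewrite !inE eqxx orbT.
have NuS : nbh M u \subset S by apply/subsetP => y yN; rewrite !in_setU yN !orbT.
have NvS : nbh M v \subset S by apply/subsetP => y yN; rewrite !in_setU yN !orbT.
have close' x y z : x != y -> [set x; y] = e -> adj M x z -> y != z -> [set y; z] \in B :|: F.
  move=> xy Exy xz yz.
  have xe : x \in [set u; v] by rewrite -Ee -Exy set21.
  have ye : y \in [set u; v] by rewrite -Ee -Exy set22.
  have sS w : w \in [set u; v] -> w \in S by rewrite !inE => ->.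
  apply: (close x y z) => //; try exact: sS.
  by move: xe; rewrite !inE => /orP[] /eqP ->.
move=> x y z /andP[/= xy /setUP xyM] /andP[xz /setUP xzM] yz.
case: xyM => [xyM|/set1P xye]; case: xzM => [xzM|/set1P xze].
- by rewrite inE (guard x) //; apply/andP; split.
- by rewrite setUC; apply: (close' x) => //; [apply/andP|rewrite eq_sym].
- by apply: (close' x) => //; apply/andP.
- by move: yz; rewrite -xze in xye; rewrite (set2_inj_l xye) eqxx.
Qed.

Theorem Breaker_wins_triangle first : wins triangle_game n m first Breaker.
Proof.
apply: (@Breaker_wins_of_rounds n m triangle_game first triangle_guarded).
- split=> /=; first by rewrite -setI_eq0 setI0.
    by move=> u; right; rewrite nbh0 cards0 muln0.
  by move=> x y z /andP[_]; rewrite inE.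
- exact: triangle_guarded_not_won.
- exact: triangle_guarded_step.
Qed.

End TriangleBreaker.

(** * Maker's strategy in the triangle game *)

Section TriangleMaker.
Variables (n m : nat).
Hypothesis m_gt0 : 0 < m.
Hypothesis n_large : 20 * (m * m) <= n.

Lemma triangle_game_sub (G G' : graph n) :
  G \subset G' -> triangle_game G -> triangle_game G'.
Proof. by move=> /adj_sub sub [x [y [z [xy yz xz]]]]; exists x, y, z; split; exact: sub. Qed.

(** [#|L|] also counts the rounds played, in each of which Breaker takes at most [m^2] edges, at
    most [m] of them at [v]. *)
Definition star_position (v : 'I_n) (P : position n) (L : {set 'I_n}) : Prop :=
  [/\ v \notin L, #|L| <= 2 * m, maker_graph P = [set [set v; l] | l in L] &
   [/\ breaker_graph P \subset Kn_edges n, #|breaker_graph P| <= #|L| * (m * m) &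
       #|nbh (breaker_graph P) v| <= #|L| * m]].

Definition triangle_threat (v : 'I_n) (P : position n) : Prop :=
  exists u, exists2 T : {set 'I_n}, m < #|T| & adj (maker_graph P) v u /\
    forall l, l \in T -> [/\ adj (maker_graph P) v l, l != u & [set u; l] \in unclaimed P].

(** Breaker's edges lie within [m] vertices, so they miss some vertex of [T]. *)
Lemma triangle_threat_step v P F : triangle_threat v P -> legal_move m Breaker P F ->
  exists2 e, e \in unclaimed (claim Breaker P F) &
    triangle_game (maker_graph (claim Maker (claim Breaker P F) [set e])).
Proof.
move=> [u [T mT [vu TP]]] [FU [S Sm SF]].
have /subsetPn [l lT lS] : ~~ (T \subset S).
  by apply/negP => /subset_leq_card; rewrite leqNgt (leq_ltn_trans Sm).
have [vl lu ulU] := TP l lT; exists [set u; l].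
  have ulF : [set u; l] \notin F.
    apply/negP => /SF /subsetP /(_ l); rewrite set22 => /(_ isT).
    by rewrite (negPf lS).
  by move: ulU; rewrite !in_setD !in_setU !negb_or ulF andbT.
have sub := adj_sub (subsetUl (maker_graph P) [set [set u; l]]).
exists v, u, l; split; [exact: sub| |exact: sub].
by rewrite /adj /= eq_sym lu !inE eqxx orbT.
Qed.

Lemma star_free_vertex v P (L : {set 'I_n}) F : star_position v P L ->
  legal_move m Breaker P F ->
  let P' := claim Breaker P F in let t := #|L| in
  [/\ breaker_graph P' \subset Kn_edges n, #|breaker_graph P'| <= t.+1 * (m * m),
      #|nbh (breaker_graph P') v| <= t.+1 * m &
      forall w, w \notin v |: L :|: nbh (breaker_graph P') v ->
        [set v; w] \in unclaimed P'].
Proof.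
move=> [vL tm EM [BK cB cN]] leg P' t.
have cF := card_legal_Breaker leg.
have BK' : breaker_graph P' \subset Kn_edges n.
  rewrite subUset BK (subset_trans leg.1) //; apply/subsetP => f.
  by rewrite in_setD => /andP[].
split=> //.
- by apply: leq_trans (leq_card_setU _ _).1 _; rewrite mulSn addnC leq_add.
- case: leg => _ [S Sm SF]; rewrite nbhU.
  apply: leq_trans (leq_card_setU _ _).1 _; rewrite mulSn addnC leq_add //.
  apply: leq_trans Sm; apply: subset_leq_card; apply/subsetP => w; rewrite inE => /andP[_].
  by move=> /SF /subsetP; apply; rewrite set22.
move=> w; rewrite !in_setU in_set1 !negb_or -andbA => /and3P[wv wL wN].
have vw : v != w by rewrite eq_sym.
rewrite in_setD edge_Kn // andbT in_setU negb_or; apply/andP; split.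
  rewrite /= EM; apply/negP => /imsetP [l lL /set2_inj_l wl].
  by rewrite wl lL in wL.
by move: wN; rewrite inE /adj /= vw.
Qed.

Lemma star_position_step v P (L : {set 'I_n}) F : star_position v P L ->
  legal_move m Breaker P F ->
  let P' := claim Breaker P F in
  exists2 e, e \in unclaimed P' & let P'' := claim Maker P' [set e] in
    (exists L', star_position v P'' L') \/ triangle_threat v P''.
Proof.
move=> starP leg P'; have [BK cB cN free] := star_free_vertex starP leg.
case: starP => vL tm EM _; set B := breaker_graph P' in BK cB cN free.
pose avoid := v |: L :|: nbh B v.
have cA : #|avoid| <= 1 + #|L| + #|L|.+1 * m.
  apply: leq_trans (leq_card_setU _ _).1 _; rewrite leq_add //.
  by apply: leq_trans (leq_card_setU _ _).1 _; rewrite cards1.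
have := cardsC avoid; rewrite card_ord => cC.
have avoidP w : w \notin avoid -> [/\ w != v, w \notin L & [set v; w] \in unclaimed P'].
  move=> wa; split; last exact: free.
    by apply: contraNneq wa => ->; rewrite !inE eqxx.
  by apply: contraNN wa => wL; rewrite !in_setU wL orbT.
case: (ltnP #|L| (2 * m)) => [tlt|tge].
  have /card_gt0P [w] : 0 < #|~: avoid|.
    move: cA cC; move: #|avoid| #|~: avoid| #|L| tlt => a c t; nia.
  rewrite inE => /avoidP [wv wL vw]; exists [set v; w] => //=; left; exists (w |: L).
  have cL : #|w |: L| = #|L|.+1 by rewrite cardsU1 wL.
  split; rewrite ?cL //; first by rewrite !inE negb_or eq_sym wv.
  by rewrite /= EM imsetU1 setUC.
have tE : #|L| = 2 * m by apply/eqP; rewrite eqn_leq tm.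
pose bad w := [set l in L | [set w; l] \in B].
(* Otherwise Breaker's at most [(2m+1) m^2] edges allow at most [4 (2m+1) m] vertices outside
   [avoid], whereas [n >= 20 m^2] leaves more. Fewer than [m] bad leaves out of [2m] leave more than
   [m] good ones. *)
have [w wa wbad] : exists2 w, w \notin avoid & #|bad w| < m.
  apply: contrapT => no.
  have all_bad w : w \in ~: avoid -> m <= #|bad w|.
    by rewrite inE => wa; rewrite leqNgt; apply/negP => lt; apply: no; exists w.
  have le1 : #|~: avoid| * m <= 4 * #|B|.
    apply: leq_trans (card_ordered_pairs BK).
    have -> : #|~: avoid| * m = \sum_(w in ~: avoid) m by rewrite sum_nat_const.
    apply: (@leq_trans (\sum_(w in ~: avoid) #|bad w|)); first exact: leq_sum.
    under eq_bigr do rewrite -sum1_card.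
    rewrite pair_big_dep /= sum1_card; apply: subset_leq_card.
    by apply/subsetP => -[x y] /andP[_ /=]; rewrite !inE => /andP[].
  move: cA cC le1 cB; rewrite tE; move: #|avoid| #|~: avoid| #|B| => a c d h1 h2 h3 h4.
  have : c * m <= (4 * ((2 * m).+1 * m)) * m by nia.
  rewrite leq_pmul2r //; nia.
have [wv wL vw] := avoidP w wa; exists [set v; w] => //=; right.
exists w, (L :\: bad w).
  have := cardsD L (bad w); rewrite (setIidPr _) ?tE; first by move: #|_ :\: _| #|bad w| wbad; lia.
  by apply/subsetP => l; rewrite inE => /andP[].
split; first by rewrite /adj /= eq_sym wv !inE eqxx orbT.
move=> l; rewrite in_setD => /andP[lb lL]; have lv : l != v by apply: contraNneq vL => <-.
have lw : l != w by apply: contraNneq wL => <-.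
split=> //.
  rewrite /adj /= eq_sym lv in_setU EM; apply/orP; left; exact: imset_f.
rewrite in_setD edge_Kn ?andbT ?(eq_sym w) // !in_setU !negb_or.
have vwl : v \notin [set w; l] by rewrite !inE negb_or !(eq_sym v) wv lv.
apply/andP; split; [apply/andP; split|].
- rewrite /= EM; apply/negP => /imsetP [l' _ E].
  by rewrite E set21 in vwl.
- by apply/negP => /set1P E; rewrite E set21 in vwl.
by rewrite -negb_or -in_setU; apply: contra lb => h; rewrite [l \in bad w]in_set lL; exact: h.
Qed.

Theorem Maker_wins_triangle first : wins triangle_game n m first Maker.
Proof.
have n0 : 0 < n by apply: leq_trans n_large; rewrite !muln_gt0 m_gt0.
pose v := Ordinal n0.
apply: (@Maker_wins_of_rounds n m triangle_game first (fun P =>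
  [\/ triangle_game (maker_graph P), exists L, star_position v P L | triangle_threat v P])).
  constructor 2; exists set0; split; rewrite ?inE ?cards0 ?imset0 //.
  by split; rewrite /= ?sub0set ?nbh0 ?cards0.
move=> P F IP leg P'.
have won : triangle_game (maker_graph P') ->
    (unclaimed P' = set0 -> triangle_game (maker_graph P')) /\
    (unclaimed P' <> set0 -> exists2 e, e \in unclaimed P' &
      [\/ triangle_game (maker_graph (claim Maker P' [set e])),
          exists L, star_position v (claim Maker P' [set e]) L |
          triangle_threat v (claim Maker P' [set e])]).
  move=> tri; split=> // /eqP /set0Pn [e eU]; exists e => //; constructor 1.
  by apply: triangle_game_sub tri; exact: subsetUl.
have step e : e \in unclaimed P' ->
      [\/ triangle_game (maker_graph (claim Maker P' [set e])),
          exists L, star_position v (claim Maker P' [set e]) L |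
          triangle_threat v (claim Maker P' [set e])] ->
    (unclaimed P' = set0 -> triangle_game (maker_graph P')) /\
    (unclaimed P' <> set0 -> exists2 e, e \in unclaimed P' &
      [\/ triangle_game (maker_graph (claim Maker P' [set e])),
          exists L, star_position v (claim Maker P' [set e]) L |
          triangle_threat v (claim Maker P' [set e])]).
  by move=> eU Ie; split=> [U0|_]; [rewrite U0 inE in eU|exists e].
case: IP => [|[L star]|threat]; first exact: won.
  have [e eU [h|h]] := star_position_step star leg; apply: (step e) => //.
    by constructor 2.
  by constructor 3.
by have [e eU tri] := triangle_threat_step threat leg; apply: (step e) => //; constructor 1.
Qed.

End TriangleMaker.

(** * Connectivity *)

Lemma next_neq_prev (T : eqType) (c : seq T) x :
  uniq c -> 2 < size c -> x \in c -> next c x != prev c x.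
Proof.
move=> uc c2 xc; apply/eqP => E; have := next_prev uc x; rewrite -E.
have [i r Er] := rot_to xc; rewrite -!(next_rot i uc) Er.
have : uniq (x :: r) by rewrite -Er rot_uniq.
have : 2 < size (x :: r) by rewrite -Er size_rot.
case: r {Er} => [|a [|b r]] //= _ /and3P[]; rewrite !inE !negb_or => /and3P[xa xb _] _ _.
by rewrite eqxx [a == x]eq_sym (negPf xa) eqxx => bx; rewrite bx eqxx in xb.
Qed.

(** The edges of the path form a spanning tree. On a cycle, the vertex furthest along the path would
    have two distinct neighbours, both equal to its predecessor on the path. *)
Lemma hamiltonian_connectivity n (G : graph n) :
  0 < n -> hamiltonicity_game G -> connectivity_game G.
Proof.
move=> n0 [s [us szs srt]]; pose x0 := Ordinal n0; pose nx i := nth x0 s i.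
have srtP i : i.+1 < n -> adj G (nx i) (nx i.+1).
  by move=> lti; move/(sortedP x0): srt; apply; rewrite szs.
pose T := [set [set nx i; nx i.+1] | i : 'I_n & i.+1 < n].
have ins y : y \in s.
  have := card_uniqP us; rewrite szs => cs.
  have cE : #|s| = #|[set: 'I_n]| by rewrite cs cardsT card_ord.
  have /(subset_cardP cE) -> : s \subset [set: 'I_n] by apply/subsetP => z; rewrite inE.
  by rewrite inE.
have adjT i : i.+1 < n -> adj T (nx i) (nx i.+1).
  move=> lti; have /andP[ne _] := srtP i lti; rewrite /adj /= ne /=.
  by apply/imsetP; exists (Ordinal (ltnW lti)); rewrite ?inE.
have idx i : i < n -> index (nx i) s = i by move=> lti; rewrite index_uniq ?szs.
have adj_idx x y : adj T x y -> index y s = (index x s).+1 \/ index x s = (index y s).+1.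
  case/andP=> xy /imsetP [i]; rewrite inE => lti E.
  have : x \in [set nx i; nx i.+1] by rewrite -E set21.
  have : y \in [set nx i; nx i.+1] by rewrite -E set22.
  have li := idx i (ltnW lti); have li1 := idx _ lti.
  rewrite !inE => /orP[] /eqP ye /orP[] /eqP xe; move: xy; rewrite ye xe ?eqxx // li li1; auto.
exists T.
  apply/subsetP => f /imsetP [i lti ->]; rewrite inE in lti.
  by have /andP[] := srtP i lti.
split.
- apply/subsetP => f /imsetP [i lti ->]; rewrite inE in lti.
  by apply: edge_Kn; have /andP[] := srtP i lti.
- have cT0 i : i < n -> connect (adj T) (nx 0) (nx i).
    elim: i => [_|i IH lti]; first exact: connect0.
    exact: connect_trans (IH (ltnW lti)) (connect1 (adjT i lti)).
  have cT y : connect (adj T) (nx 0) y.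
    by rewrite -(nth_index x0 (ins y)); apply: cT0; rewrite -[X in _ < X]szs index_mem ins.
  move=> x y; apply: (@connect_trans _ _ (nx 0)); last exact: cT.
  by rewrite (sym_connect_sym (@adj_sym n T)).
move=> c c2 /andP[cyc uc].
have [x xc] : exists x, x \in c by case: c c2 {cyc uc} => // x c _; exists x; exact: mem_head.
case: (arg_maxnP (fun y => index y s) (xc : mem c x)) => y yc ymax.
have := adj_idx _ _ (next_cycle cyc yc); have := adj_idx _ _ (prev_cycle cyc yc).
have nc : next c y \in c by rewrite mem_next.
have pc : prev c y \in c by rewrite mem_prev.
have := ymax _ nc; have := ymax _ pc => /= le1 le2 h1 h2.
have /eqP := next_neq_prev uc c2 yc; apply.
case: h1 => [h1|h1]; last by rewrite h1 ltnn in le1.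
case: h2 => [h2|h2]; first by rewrite h2 ltnn in le2.
have : index (next c y) s = index (prev c y) s by apply: succn_inj; rewrite -h1 -h2.
by move=> E; rewrite -[LHS](nth_index x0 (ins _)) E nth_index.
Qed.

(** * Breaker's isolation of a vertex *)

Definition untouched n (G : graph n) (a : 'I_n) := forall e, e \in G -> a \notin e.

Lemma untouched_not_connected n (G : graph n) a :
  1 < n -> untouched G a -> ~ connectivity_game G.
Proof.
move=> n1 un [T /subsetP TG [_ conn _]].
have [b ba] : exists b : 'I_n, b != a.
  have /card_gt0P [b] : 0 < #|~: [set a]| by rewrite cardsC1 card_ord; lia.
  by rewrite !inE; exists b.
have /connectP [[|c p] /= pth Eb] := conn a b; first by rewrite Eb eqxx in ba.
by case/andP: pth => /andP[_ /TG /un]; rewrite set21.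
Qed.

Section Isolation.
Variables (n m h : nat).
Hypothesis m_large : 2 * h <= m.

Definition cleared (B : graph n) (c : nat) (a : 'I_n) :=
  forall w : 'I_n, w != a -> w < c -> [set a; w] \in B.

Lemma cleared_sub (B B' : graph n) c a : B \subset B' -> cleared B c a -> cleared B' c a.
Proof. by move=> /subsetP sub cl w wa wc; apply: sub; exact: cl. Qed.

(** Breaker takes the free edges inside [S] and the [j]-th block, at most [2h] vertices. Since Maker
    has no edge at [S], all edges between [S] and the block are then his. *)
Lemma clear_block (P : position n) (S : {set 'I_n}) j : #|S| <= h ->
  (forall a, a \in S -> untouched (maker_graph P) a /\ cleared (breaker_graph P) (j * h) a) ->
  exists2 F, legal_move m Breaker P F &
    forall a, a \in S -> cleared (breaker_graph P :|: F) (j.+1 * h) a.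
Proof.
move=> Sh SP; pose T := [set w : 'I_n | j * h <= w < j.+1 * h].
have cT : #|T| <= h.
  rewrite cardE -(size_map (@nat_of_ord n)) -[leqRHS](size_iota (j * h)).
  apply: uniq_leq_size; first by rewrite (map_inj_uniq val_inj) enum_uniq.
  move=> y /mapP [w wT ->]; move: wT; rewrite mem_enum inE => /andP[lo hi].
  by rewrite mem_iota lo -mulSnr.
pose F := [set f in unclaimed P | f \subset S :|: T].
exists F.
  split; first by apply/subsetP => f; rewrite inE => /andP[].
  exists (S :|: T) => [|f]; last by rewrite inE => /andP[].
  by apply: leq_trans (leq_card_setU _ _).1 _; apply: leq_trans m_large; rewrite mul2n -addnn leq_add.
move=> a aS w wa wj; have [un cl] := SP a aS; rewrite in_setU.
case: (ltnP w (j * h)) => [wlo|whi]; first by rewrite cl.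
case: (boolP ([set a; w] \in breaker_graph P)) => //= nB.
rewrite [_ \in F]in_set in_setD edge_Kn 1?eq_sym // in_setU negb_or nB !andbT.
apply/andP; split; first by apply/negP => /un; rewrite set21.
apply/subsetP => y; rewrite in_set2 in_setU => /orP[] /eqP ->; first by rewrite aS.
by rewrite [w \in T]in_set whi wj orbT.
Qed.

Lemma cards_kill (A U e : {set 'I_n}) : [disjoint A & U] -> #|e| = 2 ->
  #|A| + #|U| <= #|A :\: e| + #|U :\: e| + 2.
Proof.
move=> dAU e2; have := cardsID e A; have := cardsID e U.
have : #|A :&: e| + #|U :&: e| <= 2.
  have <- : #|(A :&: e) :|: (U :&: e)| = #|A :&: e| + #|U :&: e|.
    apply/eqP; rewrite (leq_card_setU _ _).2.
    by apply: disjointW dAU; exact: subsetIl.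
  by rewrite -e2; apply: subset_leq_card; rewrite -setIUl subsetIr.
move: #|A :&: e| #|U :&: e| #|A :\: e| #|U :\: e| #|A| #|U| => *; lia.
Qed.

Variables (R : realFieldType) (r : nat).
Local Notation rho := (1 - 4 / h%:R : R)%R.
Local Notation x j := (n%:R * rho ^+ j)%R.
Hypothesis h_large : 4 <= h.
Hypothesis n_gt1 : 1 < n.
Hypothesis n_blocks : n <= r * h.
Hypothesis many_left : ((h + 2)%:R <= x r)%R.

(* [x j] is the number of candidates guaranteed at the start of sweep [j]. Within a
   sweep, Maker lowers [#|A| + rho * #|U|] by at most 2 per turn, while moving [h]
   vertices from [U] (to be processed) to [A] raises it by 4. *)
Definition sweep_start (P : position n) (j : nat) (U : {set 'I_n}) : Prop :=
  [/\ j <= r, (x j <= #|U|%:R)%R &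
   forall a, a \in U -> untouched (maker_graph P) a /\ cleared (breaker_graph P) (j * h) a].

Definition sweep_mid (P : position n) (j : nat) (A U : {set 'I_n}) : Prop :=
  [/\ j < r, [disjoint A & U], (x j.+1 + 2 <= #|A|%:R + rho * #|U|%:R)%R,
   forall a, a \in A -> untouched (maker_graph P) a /\ cleared (breaker_graph P) (j.+1 * h) a &
   forall a, a \in U -> untouched (maker_graph P) a /\ cleared (breaker_graph P) (j * h) a].

Definition isolating (P : position n) : Prop :=
  (exists j U, sweep_start P j U) \/ (exists j A U, sweep_mid P j A U).

Let h0 : (0 < h%:R :> R)%R. Proof. by rewrite ltr0n; lia. Qed.

Let hrho : (h%:R * rho = h%:R - 4)%R.
Proof. by rewrite mulrBr mulr1 mulrCA mulfV ?mulr1 // gt_eqF. Qed.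

Let rho_ge0 : (0 <= rho)%R.
Proof. by rewrite subr_ge0 ler_pdivrMr // mul1r ler_nat. Qed.

Let rho_le1 : (rho <= 1)%R.
Proof. by rewrite gerBl divr_ge0 // ltW. Qed.

Let x_ge j : j <= r -> (h%:R + 2 <= x j)%R.
Proof.
move=> jr; apply: le_trans (_ : x r <= _)%R; first by rewrite -natrD.
by rewrite ler_wpM2l // ler_wiXn2l.
Qed.

Lemma isolating_not_won P : isolating P -> ~ connectivity_game (maker_graph P).
Proof.
move=> iso; suff [a un] : exists a, untouched (maker_graph P) a.
  exact: untouched_not_connected un.
case: iso => [[j [U [jr xU UP]]]|[j [A [U [jr _ xAU AP UP]]]]].
  have /card_gt0P [a /UP [un _]] : 0 < #|U|; last by exists a.
  rewrite -(ltr0n R); apply: lt_le_trans xU; apply: lt_le_trans (x_ge jr).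
  by rewrite addr_gt0.
have [A0|[a /AP [un _]]] := set_0Vmem A; last by exists a.
have [U0|[a /UP [un _]]] := set_0Vmem U; last by exists a.
move: xAU (x_ge jr) h0; rewrite A0 U0 cards0 mulr0.
by move: (n%:R * (1 - 4 / h%:R) ^+ j.+1 : R)%R => y; lra.
Qed.

Lemma untouchedU (G : graph n) (e : {set 'I_n}) a :
  untouched G a -> a \notin e -> untouched (G :|: [set e]) a.
Proof. by move=> un ae f /setUP [/un //|/set1P ->]. Qed.

(** If at least [h] vertices of [U] survive Maker's edge, Breaker processes [h] of them; otherwise
    he processes all the rest, and the next sweep starts. The disjunction treats the first turn of a
    sweep together with the later ones. *)
Lemma isolating_sweep P e j (A U : {set 'I_n}) : j < r -> [disjoint A & U] ->
  e \in unclaimed P ->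
  (forall a, a \in A -> untouched (maker_graph P) a /\ cleared (breaker_graph P) (j.+1 * h) a) ->
  (forall a, a \in U -> untouched (maker_graph P) a /\ cleared (breaker_graph P) (j * h) a) ->
  (x j.+1 + 2 <= #|A|%:R + rho * #|U|%:R)%R \/ A = set0 /\ (x j <= #|U|%:R)%R ->
  exists2 F, legal_move m Breaker (claim Maker P [set e]) F &
    isolating (claim Breaker (claim Maker P [set e]) F).
Proof.
move=> jr dAU eU AP UP num; set P1 := claim Maker P [set e].
have e2 : #|e| = 2 by move: eU; rewrite in_setD => /andP[_]; rewrite inE => /eqP.
have unM a : untouched (maker_graph P) a -> a \notin e -> untouched (maker_graph P1) a.
  exact: untouchedU.
have kill := cards_kill dAU e2.
set A0 := A :\: e in kill; set U0 := U :\: e in kill.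
have A0A : #|A0| <= #|A| by rewrite subset_leq_card // subsetDl.
have U0U : #|U0| <= #|U| by rewrite subset_leq_card // subsetDl.
have killR : (#|A|%:R + rho * #|U|%:R <= #|A0|%:R + rho * #|U0|%:R + 2 :> R)%R.
  have k1 : (#|A|%:R + #|U|%:R <= #|A0|%:R + #|U0|%:R + 2 :> R)%R by rewrite -!natrD ler_nat.
  have k2 : (#|A0|%:R <= #|A|%:R :> R)%R by rewrite ler_nat.
  have k3 : (#|U0|%:R <= #|U|%:R :> R)%R by rewrite ler_nat.
  move: k1 k2 k3 rho_ge0 rho_le1; move: (1 - 4 / h%:R : R)%R (#|A|%:R : R)%R (#|U|%:R : R)%R.
  move: (#|A0|%:R : R)%R (#|U0|%:R : R)%R => a0 u0 rh a u; nra.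
have d0 : [disjoint A0 & U0] by apply: disjointW dAU; exact: subsetDl.
have A0P a : a \in A0 -> untouched (maker_graph P1) a /\ cleared (breaker_graph P1) (j.+1 * h) a.
  by rewrite in_setD => /andP[ae /AP [un cl]]; split=> //; exact: unM.
have U0P a : a \in U0 -> untouched (maker_graph P1) a /\ cleared (breaker_graph P1) (j * h) a.
  by rewrite in_setD => /andP[ae /UP [un cl]]; split=> //; exact: unM.
have xj1 : (x j.+1 = rho * x j)%R by rewrite exprS mulrCA.
case: (leqP h #|U0|) => [hU|Uh].
  have [S SU cS] := exists_subset_card hU.
  have [|a /(subsetP SU) /U0P //|F leg FP] := @clear_block P1 S j; first by rewrite cS.
  exists F => //; right; exists j, (A0 :|: S), (U0 :\: S).
  have dAS : [disjoint A0 & S] by apply: disjointWr d0.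
  have cAS : #|A0 :|: S| = #|A0| + h by apply/eqP; rewrite -cS (leq_card_setU _ _).2.
  have cUS : (#|U0 :\: S|%:R = #|U0|%:R - h%:R :> R)%R.
    by rewrite cardsD (setIidPr SU) cS natrB.
  split=> //.
  - rewrite -setI_eq0 setIUl setU_eq0; apply/andP; split.
      by rewrite setI_eq0; apply: disjointWr d0; exact: subsetDl.
    by rewrite setIDA setDIl setDv set0I.
  (* As [rho h = h - 4], processing [h] vertices gains 4 and Maker's edge costs at most 2; the net
     gain supplies the surplus 2 on the first turn. *)
  - rewrite cAS cUS natrD mulrBr [(rho * h%:R)%R]mulrC hrho.
    case: num => [num|[A0' num]]; first by lra.
    have cA0 : #|A0| = 0 by apply/eqP; rewrite cards_eq0 /A0 A0' set0D.
    move: killR; rewrite A0' cards0 cA0 xj1; move: num rho_ge0 rho_le1.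
    move: (1 - 4 / h%:R : R)%R (#|U0|%:R : R)%R (#|U|%:R : R)%R => rh u0 u.
    by move: (n%:R * rh ^+ j)%R => y; nra.
  - move=> a /setUP [/A0P [un cl]|aS].
      by split=> //; apply: cleared_sub cl; exact: subsetUl.
    by split; [have [] := U0P a (subsetP SU a aS)|exact: FP].
  - move=> a; rewrite in_setD => /andP[_ /U0P [un cl]]; split=> //.
    by apply: cleared_sub cl; exact: subsetUl.
have [|a /U0P //|F leg FP] := @clear_block P1 U0 j; first exact: ltnW.
exists F => //; left; exists j.+1, (A0 :|: U0).
have cAU : #|A0 :|: U0| = #|A0| + #|U0| by apply/eqP; rewrite (leq_card_setU _ _).2.
split=> //.
- have u0 : (0 <= #|U0|%:R :> R)%R by [].
  have Uh' : (#|U0|%:R < h%:R :> R)%R by rewrite ltr_nat.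
  rewrite cAU natrD; case: num => [num|[A0' num]].
    move: killR num u0 rho_le1; move: (1 - 4 / h%:R : R)%R (#|U0|%:R : R)%R => rh v.
    by move: (n%:R * rh ^+ j.+1)%R => y; nra.
  (* A sweep cannot end on its first turn: [#|U| >= x j >= h + 2] leaves at least [h] vertices in
     [U0]. *)
  have cA0 : #|A0| = 0 by apply/eqP; rewrite cards_eq0 /A0 A0' set0D.
  have := x_ge (ltnW jr); move: kill; rewrite A0' cards0 cA0 !add0n -(ler_nat R) natrD.
  by lra.
- move=> a /setUP [/A0P [un cl]|aU].
    by split=> //; apply: cleared_sub cl; exact: subsetUl.
  by split; [have [] := U0P a aU|exact: FP].
Qed.

Lemma isolating_step P e : isolating P -> e \in unclaimed P ->
  exists2 F, legal_move m Breaker (claim Maker P [set e]) F &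
    isolating (claim Breaker (claim Maker P [set e]) F).
Proof.
case=> [[j [U [jr xU UP]]]|[j [A [U [jr dAU xAU AP UP]]]]] eU; last first.
  by apply: isolating_sweep eU AP UP _ => //; left.
case: (ltnP j r) => [jlt|rj].
  apply: (@isolating_sweep P e j set0 U) => //; last by right.
    by rewrite -setI_eq0 set0I.
  by move=> a; rewrite inE.
(* After [r] sweeps every edge at a vertex of [U] is Breaker's, so Maker's edge misses [U] and
   Breaker can pass. *)
exists set0; first exact: legal_Breaker0.
rewrite claim_Breaker0; left; exists j, U; split=> // a aU.
have [un cl] := UP a aU; split=> //; apply: untouchedU => //.
move: eU; rewrite in_setD in_setU negb_or => /andP[/andP[_ eB]].
rewrite inE => /cards2P [y [z [yz Ee]]].
have jn (w : 'I_n) : w < j * h.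
  by apply: leq_trans (ltn_ord w) _; apply: leq_trans n_blocks _; rewrite leq_mul2r rj orbT.
apply/negP; rewrite Ee in_set2 => /orP[] /eqP ay; case/negP: eB.
  by rewrite Ee -ay; apply: cl => //; rewrite ay eq_sym.
by rewrite Ee setUC -ay; apply: cl => //; rewrite ay.
Qed.

Theorem Breaker_wins_connectivity first : wins connectivity_game n m first Breaker.
Proof.
apply: (@Breaker_wins_of_rounds n m connectivity_game first isolating).
- left; exists 0, setT; split=> //; first by rewrite expr0 mulr1 cardsT card_ord.
  by move=> a _; split=> [e|w _]; rewrite ?inE.
- exact: isolating_not_won.
- exact: isolating_step.
Qed.

End Isolation.

From mathcomp Require Import all_classical all_reals all_analysis.
Import numFieldNormedType.Exports.
Local Open Scope ring_scope.
Local Open Scope classical_set_scope.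

(** * Asymptotics *)

(** With [k] about [n / 20], [n <= 40k] gives [n^2 <= 1600 k^2], so [p + 1 = 8 * 1600] is constant
    and [s] is [O(n)]. All conditions then reduce to [(m^2 + 1) l = O(n)]. *)
Lemma Maker_wins_hamiltonicity_large : exists2 D : nat, (0 < D)%N &
  forall n m l first, (20 <= n)%N -> (n < 2 ^ l)%N ->
    (D * ((m * m).+1 * l) <= n)%N -> wins hamiltonicity_game n m first Maker.
Proof.
have [p pE] : exists p, (p.+1 = 128 * 100)%N by exists (128 * 100).-1%N; rewrite prednK.
have [D DE] : exists D, (D = 16 * 1600 * (6 * p.+1 + 8))%N by eexists.
exists D => [|n m l first n20 nl Dn]; first by rewrite DE.
pose k := (n %/ 20)%N; pose s := (p.+1 * (2 * n + 1) + 8 * k + n)%N.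
have kn : (20 * k <= n)%N by rewrite mulnC leq_trunc_div.
have k0 : (0 < k)%N by rewrite divn_gt0.
have nk : (n <= 40 * k)%N.
  by have := ltn_ceil n (isT : 0 < 20)%N; rewrite -/k; lia.
have l0 : (0 < l)%N by case: (l) nl => //; rewrite expn0; lia.
have nn : (n * n <= 1600 * (k * k))%N by nia.
have sn : (s <= (3 * p.+1 + 2) * n)%N by rewrite /s; nia.
apply: (@Maker_wins_hamiltonicity n m k p s l first) => //.
- by rewrite pE; lia.
- by apply: leq_trans Dn; rewrite leq_mul // DE; lia.
set u := (m * m).+1 in Dn *.
have le1 : (2 * l * s + 4 <= l * ((6 * p.+1 + 8) * n))%N.
  have : (l * (2 * s) <= l * ((6 * p.+1 + 4) * n))%N by rewrite leq_mul2l; apply/orP; right; lia.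
  have : (4 <= l * (4 * n))%N by nia.
  by rewrite !mulnDl !mulnDr; lia.
have le2 : (1600 * (16 * (u * (2 * l * s + 4))) <= 1600 * (k * k))%N.
  apply: leq_trans nn; apply: leq_trans (_ : D * (u * l) * n <= _)%N; last by rewrite leq_mul2r Dn orbT.
  apply: leq_trans (_ : 1600 * (16 * (u * (l * ((6 * p.+1 + 8) * n)))) <= _)%N.
    by rewrite !leq_mul2l le1 !orbT.
  by rewrite DE; apply: eq_leq; ring.
by rewrite leq_pmul2l in le2.
Qed.

Section Asymptotics.
Variable R : realType.

(** Where the two wins are known, the threshold lies between [a] and [N]; for the remaining [n] the
    value of [m0] is arbitrary. *)
Lemma threshold_bias_Theta_of_wins (W : winning_family) (f : nat -> R) (c C : R) :
  0 < c -> 0 < C ->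
  (forall first, \forall n \near \oo, 0 <= f n /\
     exists a N, [/\ (a <= N)%N, c * f n <= a%:R, N%:R <= C * f n,
       wins W n a first Maker & forall m, (N < m)%N -> wins W n m first Breaker]) ->
  threshold_bias_Theta W f.
Proof.
move=> c0 C0 wW first.
pose good n m0 := [/\ c * f n <= m0%:R, m0%:R <= C * f n & threshold_bias W first n m0].
have goodP n : exists m0, (exists m0', good n m0') -> good n m0.
  by case: (pselect (exists m0', good n m0')) => [[m0 gm]|no]; [exists m0|exists 0%N].
have [m0 m0P] := choice goodP; exists m0.
have near_good : \forall n \near \oo, 0 <= f n /\ good n (m0 n).
  apply: filterS (wW first) => n [f0 [a [N [aN ca NC wa wN]]]]; split=> //.
  apply: m0P; have [m /andP[am mN] thr] := threshold_bias_between aN wa wN.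
  exists m; split=> //; first by apply: le_trans ca _; rewrite ler_nat.
  by apply: le_trans NC; rewrite ler_nat.
split; first by apply: filterS near_good => n [_ []].
rewrite eqThetaE qualifE; apply/asboolP; exists (c, C) => /=; first by rewrite c0.
apply: filterS near_good => n [f0 [lo hi _]].
by rewrite ger0_norm // normr_nat.
Qed.

Lemma truncn_ge_half (y : R) : 2 <= y -> y / 2 <= (Num.truncn y)%:R.
Proof. by move=> y2; have := truncnS_gt y; rewrite -natr1; lra. Qed.

Lemma truncn_le_nneg (y : R) : 0 <= y -> (Num.truncn y)%:R <= y.
Proof. by move=> y0; rewrite truncn_le. Qed.

Lemma near_sqrt_ge (x : R) : \forall n \near \oo, x <= Num.sqrt n%:R :> R.
Proof.
apply: filterS (nbhs_infty_ger (x ^+ 2)) => n; rewrite -ler_sqrt // sqrtr_sqr.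
exact: le_trans (ler_norm _).
Qed.

Theorem triangle_threshold :
  threshold_bias_Theta triangle_game (fun n => Num.sqrt n%:R : R).
Proof.
apply: (@threshold_bias_Theta_of_wins _ _ (10^-1) 5) => // first.
apply: filterS (near_sqrt_ge 10) => n; set y := Num.sqrt _ => y10.
have yy : y * y = n%:R by rewrite -expr2 sqr_sqrtr.
split; first exact: sqrtr_ge0.
(* [20 (y/5)^2 < n] serves Maker; [q > sqrt n] makes [n / q < q], so a bias above [2 + 4q] serves
   Breaker. *)
pose a := Num.truncn (y / 5); pose q := (Num.truncn y).+1.
have a_le : a%:R <= y / 5 by apply: truncn_le_nneg; lra.
have a_ge : (y / 5) / 2 <= a%:R by apply: truncn_ge_half; lra.
have q_le : q%:R <= y + 1 by rewrite -natr1 lerD2r truncn_le_nneg //; lra.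
have q_gt : y < q%:R by exact: truncnS_gt.
have aq : a%:R < q%:R :> R by lra.
rewrite ltr_nat in aq.
exists a, (2 + 4 * q)%N; split.
- by lia.
- by lra.
- by rewrite natrD natrM; lra.
- apply: Maker_wins_triangle.
    by rewrite -(ltr0n R); lra.
  by rewrite -(ler_nat R) !natrM -yy; nra.
move=> m mq; apply: (@Breaker_wins_triangle n m q) => //.
have : (n %/ q < q)%N.
  by rewrite ltn_divLR // -(ltr_nat R) natrM -yy; nra.
by lia.
Qed.

Definition sqrt_n_ln (n : nat) : R := Num.sqrt (n%:R / ln n%:R).

Lemma near_ln_ge (x : R) : \forall n \near \oo, x <= ln n%:R :> R.
Proof.
apply: filterS (nbhs_infty_ger (expR x)) => n le.
by rewrite -[x]expRK ler_ln ?posrE ?expR_gt0 // (lt_le_trans (expR_gt0 x)).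
Qed.

(** With [t = sqrt n], [ln n = 2 ln t < 2t], so [n / ln n > t / 2], which is unbounded. *)
Lemma near_sqrt_n_ln_ge (x : R) : \forall n \near \oo, x <= sqrt_n_ln n.
Proof.
near=> n.
have t1 : 2 <= Num.sqrt n%:R :> R by near: n; exact: near_sqrt_ge.
have tx : 2 * x ^+ 2 <= Num.sqrt n%:R :> R by near: n; exact: near_sqrt_ge.
have l1 : 1 <= ln n%:R :> R by near: n; exact: near_ln_ge.
apply: le_trans (ler_norm _) _; rewrite -sqrtr_sqr ler_wsqrtr //.
rewrite ler_pdivlMr; last by lra.
set t := Num.sqrt _ in t1 tx.
have tt : n%:R = t ^+ 2 by rewrite sqr_sqrtr.
have lt_t : ln t < t by apply: ln_sublinear; lra.
have lt0 : 0 <= ln t by apply: ln_ge0; lra.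
rewrite tt lnXn; last by lra.
rewrite -mulr_natr; move: (ln t) lt_t lt0 => lt lt_t lt0.
by have := sqr_ge0 x; move: tx; move: (x ^+ 2) => z; nra.
Unshelve. all: by end_near.
Qed.

Lemma sqrt_n_lnK n : 0 < ln n%:R :> R -> sqrt_n_ln n * sqrt_n_ln n * ln n%:R = n%:R.
Proof.
move=> l0; rewrite -expr2 sqr_sqrtr ?divfK //; first by rewrite gt_eqF.
by rewrite divr_ge0 // ltW.
Qed.

(** For [x <= 1/2], [1 / (1 - x) <= 1 + 2x <= e^(2x)]. *)
Lemma expR_double_le (x : R) : 0 <= x <= 2^-1 -> expR (- (2 * x)) <= 1 - x.
Proof.
case/andP=> x0 x2; have x1 : 0 < 1 - x by lra.
rewrite expRN -[leRHS]invrK lef_pV2 ?posrE ?invr_gt0 ?expR_gt0 //.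
apply: le_trans (expR_ge1Dx _); rewrite -[leLHS]mul1r ler_pdivrMr //.
by nra.
Qed.

(** With [L = ln n] and [h > 8y], [r h <= n + h] gives [8r / h <= L/8 + 1], so
    [n rho^r >= e^(7L/8 - 1)]. This is at least [11y >= h + 2], because [y <= e^(L/2)] and the
    remaining factor [e^(3L/8 - 1)] is at least 11. *)
Lemma near_Breaker_wins_connectivity : \forall n \near \oo, forall first m,
  (2 * (Num.truncn (8 * sqrt_n_ln n)).+1 < m)%N ->
  wins connectivity_game n m first Breaker.
Proof.
near=> n.
have n2 : (1 < n)%N by near: n; exact: nbhs_infty_gt.
have l30 : 30 <= ln n%:R :> R by near: n; exact: near_ln_ge.
have y1 : 1 <= sqrt_n_ln n by near: n; exact: near_sqrt_n_ln_ge.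
move=> first m; set h := (Num.truncn _).+1 => hm.
set y := sqrt_n_ln n in y1 h hm; set L := ln n%:R in l30.
have yyL : y * y * L = n%:R by apply: sqrt_n_lnK; rewrite -/L; lra.
have nE : n%:R = expR L by rewrite lnK // posrE ltr0n ltnW.
have h_gt : 8 * y < h%:R by exact: truncnS_gt.
have h_le : h%:R <= 8 * y + 1 by rewrite /h -[leLHS]natr1 lerD2r truncn_le_nneg //; lra.
have h0 : 0 < h%:R :> R by lra.
have h8 : (8 <= h)%N by rewrite -(ler_nat R); lra.
pose r := (n %/ h).+1.
have rh : (n <= r * h)%N by rewrite ltnW // ltn_ceil.
have rh' : r%:R * h%:R <= n%:R + h%:R :> R.
  by rewrite -natrM -natrD ler_nat /r mulSn addnC leq_add2r leq_trunc_div.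
apply: (@Breaker_wins_connectivity n m h _ R r) => //.
- by rewrite ltnW.
- by apply: leq_trans h8.
clearbody h r L y.
have exp_le : expR (- (L / 8 + 1)) <= (1 - 4 / h%:R) ^+ r.
  apply: le_trans (_ : expR (- (2 * (4 / h%:R))) ^+ r <= _); last first.
    apply: lerXn2r; rewrite ?nnegrE ?expR_ge0 //.
      by rewrite subr_ge0 ler_pdivrMr // mul1r ler_nat (leq_trans _ h8).
    apply: expR_double_le; rewrite divr_ge0 ?(ltW h0) //= ler_pdivrMr //.
    by lra.
  have r_le : r%:R * 8 <= (L / 8 + 1) * h%:R.
    have hh : 64 * (y * y) <= h%:R * h%:R by nra.
    have hhL : 64 * (y * y) * L <= h%:R * h%:R * L by apply: ler_wpM2r => //; lra.
    have hh8 : 8 * h%:R <= h%:R * h%:R :> R by apply: ler_wpM2r; [exact: ltW|rewrite ler_nat].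
    rewrite -(ler_pM2r h0); nra.
  rewrite -expRM_natl ler_expR mulrN lerN2.
  have -> : r%:R * (2 * (4 / h%:R)) = r%:R * 8 / h%:R :> R by ring.
  by rewrite ler_pdivrMr.
have y_le : y <= expR (L / 2).
  have ee : expR (L / 2) * expR (L / 2) = n%:R by rewrite -expRD -splitr.
  have yyn : y * y <= n%:R by nra.
  rewrite leNgt; apply/negP => lt_y; have e0 := expR_gt0 (L / 2).
  by move: ee yyn lt_y e0; move: (expR (L / 2)) => e ee yyn lt_y e0; nra.
have e11 : 11 <= expR (L * 3 / 8 - 1) by apply: le_trans (expR_ge1Dx _); lra.
apply: le_trans (_ : expR (L / 2) * expR (L * 3 / 8 - 1) <= _).
  by rewrite natrD; have := ler_pM (ltW (lt_le_trans ltr01 y1)) _ y_le e11; lra.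
rewrite -expRD; have -> : L / 2 + (L * 3 / 8 - 1) = L + - (L / 8 + 1) by lra.
by rewrite expRD -nE ler_wpM2l.
Unshelve. all: by end_near.
Qed.

Lemma near_Maker_wins_hamiltonicity : exists2 c : R, 0 < c &
  \forall n \near \oo, forall first,
    wins hamiltonicity_game n (Num.truncn (c * sqrt_n_ln n)) first Maker.
Proof.
have [D D0 winsD] := Maker_wins_hamiltonicity_large.
have D1 : 1 <= D%:R :> R by rewrite ler1n.
(* As [m^2 + 1 <= 2 (cy)^2] and [l <= 3 ln n], the product [D (m^2 + 1) l] is at most
   [6Dc * cn = cn <= n]. *)
pose c : R := (6 * D%:R)^-1.
have c0 : 0 < c by rewrite invr_gt0; lra.
have cD : 6 * D%:R * c = 1 by rewrite mulfV //; apply/eqP; lra.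
have c1 : c <= 1 by nra.
exists c => //; near=> n.
have n20 : (20 <= n)%N by near: n; exact: nbhs_infty_ge.
have l1 : 1 <= ln n%:R :> R by near: n; exact: near_ln_ge.
have y1 : c^-1 <= sqrt_n_ln n by near: n; exact: near_sqrt_n_ln_ge.
move=> first; set m := Num.truncn _.
set y := sqrt_n_ln n in y1 m *; set L := ln n%:R in l1.
have yyL : y * y * L = n%:R by apply: sqrt_n_lnK; rewrite -/L; lra.
have cy1 : 1 <= c * y by rewrite mulrC -ler_pdivrMr // mul1r.
have m_le : m%:R <= c * y by apply: truncn_le_nneg; lra.
have m1 : 1 <= m%:R :> R by rewrite ler1n truncn_gt0.
pose l := (trunc_log 2 n).+1.
have l_le : l%:R <= 3 * L.
  have ln2 : 2^-1 <= ln 2 :> R.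
    have : ln (1 + - 2^-1) <= - 2^-1 :> R by apply: le_ln1Dx; lra.
    have -> : 1 + - 2^-1 = 2^-1 :> R by lra.
    by rewrite lnV ?posrE //; lra.
  have n0 : (0 < n)%N by lia.
  have tl : ln 2 * (trunc_log 2 n)%:R <= L.
    rewrite mulr_natr -lnXn // -natrX ler_ln ?posrE ?ltr0n ?expn_gt0 //.
    by rewrite ler_nat trunc_logP.
  have t0 : 0 <= (trunc_log 2 n)%:R :> R by [].
  rewrite /l -[leLHS]natr1; move: ((trunc_log 2 n)%:R : R) (ln 2 : R) ln2 t0 tl => t u.
  by nra.
apply: (@winsD n m l) => //; first by rewrite trunc_log_ltn.
clearbody m L y l.
rewrite -(ler_nat R) !natrM -(natr1 (m * m)) natrM -yyL.
have mm : m%:R * m%:R <= c * (c * (y * y)).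
  have -> : c * (c * (y * y)) = (c * y) * (c * y) by ring.
  by apply: ler_pM.
have mm1 : m%:R * m%:R + 1 <= 2 * (c * (c * (y * y))) by nra.
have yy0 : 0 <= y * y by rewrite -expr2 sqr_ge0.
have ml : (m%:R * m%:R + 1) * l%:R <= 2 * (c * (c * (y * y))) * (3 * L).
  by apply: ler_pM => //; nra.
apply: le_trans (ler_wpM2l (ltW (lt_le_trans ltr01 D1)) ml) _.
have -> : D%:R * (2 * (c * (c * (y * y))) * (3 * L)) = (6 * D%:R * c) * (c * (y * y * L)).
  by ring.
rewrite cD mul1r; apply: ler_piMl => //.
by apply: mulr_ge0 => //; lra.
Unshelve. all: by end_near.
Qed.

(** A Hamiltonian path contains a spanning tree, so Maker's win in the Hamiltonicity game and
    Breaker's win in the connectivity game serve both thresholds. *)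
Theorem connectivity_hamiltonicity_threshold :
  threshold_bias_Theta connectivity_game sqrt_n_ln /\
  threshold_bias_Theta hamiltonicity_game sqrt_n_ln.
Proof.
have [c c0 wM] := near_Maker_wins_hamiltonicity.
have both first : \forall n \near \oo, 0 <= sqrt_n_ln n /\
    exists a N, [/\ (a <= N)%N, c / 2 * sqrt_n_ln n <= a%:R,
      N%:R <= (18 + c) * sqrt_n_ln n,
      wins hamiltonicity_game n a first Maker /\ (0 < n)%N &
      forall m, (N < m)%N -> wins connectivity_game n m first Breaker].
  near=> n.
  have n0 : (0 < n)%N by near: n; exact: nbhs_infty_gt.
  have wMn : forall first,
      wins hamiltonicity_game n (Num.truncn (c * sqrt_n_ln n)) first Maker.
    by near: n.
  have wBn : forall first m, (2 * (Num.truncn (8 * sqrt_n_ln n)).+1 < m)%N ->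
      wins connectivity_game n m first Breaker.
    by near: n; exact: near_Breaker_wins_connectivity.
  have y2 : 2 / c <= sqrt_n_ln n by near: n; exact: near_sqrt_n_ln_ge.
  have y1 : 1 <= sqrt_n_ln n by near: n; exact: near_sqrt_n_ln_ge.
  set y := sqrt_n_ln n in wMn wBn y1 y2 *.
  have cy2 : 2 <= c * y by rewrite mulrC -ler_pdivrMr.
  set a := Num.truncn (c * y) in wMn; set N1 := (2 * _)%N in wBn.
  have a_le : a%:R <= c * y by apply: truncn_le_nneg; lra.
  have N1_le : N1%:R <= 18 * y.
    have : (Num.truncn (8 * y))%:R <= 8 * y by apply: truncn_le_nneg; lra.
    by rewrite natrM -(natr1 (Num.truncn _)); lra.
  split; first by lra.
  (* Adding [a] to [N1] ensures [a <= N] and adds only [c] to the constant 18. *)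
  exists a, (N1 + a)%N; split.
  - exact: leq_addl.
  - by have := truncn_ge_half cy2; rewrite -/a; lra.
  - by rewrite natrD; lra.
  - by [].
  - by move=> m lt; apply: wBn; apply: leq_ltn_trans lt; exact: leq_addr.
split; apply: (@threshold_bias_Theta_of_wins _ _ (c / 2) (18 + c)) => [||first]; try lra.
  apply: filterS (both first) => n [y0 [a [N [aN lo hi [wa n0] wN]]]]; split=> //.
  exists a, N; split=> //; apply: wins_sub wa => P; exact: hamiltonian_connectivity.
apply: filterS (both first) => n [y0 [a [N [aN lo hi [wa n0] wN]]]]; split=> //.
exists a, N; split=> // m /wN; apply: wins_sub => P nc ham; apply: nc.
exact: hamiltonian_connectivity.
Unshelve. all: by end_near.
Qed.

End Asymptotics.

Theorem theorem1p4 (R : realType) :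
  [/\ threshold_bias_Theta triangle_game
        (fun n => Num.sqrt n%:R : R),
      threshold_bias_Theta connectivity_game
        (fun n => Num.sqrt (n%:R / ln n%:R) : R)
    & threshold_bias_Theta hamiltonicity_game
        (fun n => Num.sqrt (n%:R / ln n%:R) : R)].
Proof.
have [conn ham] := connectivity_hamiltonicity_threshold R.
by split=> //; exact: triangle_threshold.
Qed.
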